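(* Let $\psi\in F$, $\beta\in\mathbb{R}$, $n,p\in\mathbb{N}$, $p\leqslant n$. Then, as $n\to\infty$, $$\mathcal{E}(C^{\psi}_{\beta,\infty};U^{\psi}_{n,p})=\psi(n)\Big(\frac{4}{\pi^2}A^{\psi}_{n,p}+O(1)\Big),$$ where $$A^{\psi}_{n,p}=\begin{cases}\ln p, & \text{if } T(n)\leqslant 1,\\ \ln\frac{p}{T(n)}, & \text{if } 1\leqslant T(n)\leqslant p,\\ \ln\frac{T(n)}{p}, & \text{if } T(n)\geqslant p,\end{cases}$$ $T(t)=\eta(\psi;t)-t$, $\eta(\psi;n)=\psi^{-1}\big(\tfrac12\psi(n)\big)$, and $O(1)$ denotes a quantity bounded in absolute value uniformly with respect to $\beta$, $n$ and $p$.
   Context: $C$ is the space of continuous $2\pi$-periodic functions with $\|f\|_C=\max_x|f(x)|$. For $f\in C$, $a_k(f),b_k(f)$ are its Fourier coefficients, $A_0(f;x)=a_0(f)/2$, $A_k(f;x)=a_k(f)\cos kx+b_k(f)\sin kx$. $\mathfrak{M}$ is the set of all positive functions $\psi(t)$, $t\geqslant1$, that are convex (downward convex) and satisfy $\lim_{t\to\infty}\psi(t)=0$. For $\psi\in\mathfrak{M}$, $\eta(t)=\eta(\psi;t)=\psi^{-1}\big(\tfrac12\psi(t)\big)$, $t\geqslant1$, where $\psi^{-1}$ is the inverse function of $\psi$. $F=\{\psi\in\mathfrak{M}:\ \eta'(\psi;t)\leqslant K\ \ \forall t\geqslant1\}$ for some constant $K$ (depending on $\psi$). For $\psi\in F$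 and $\beta\in\mathbb{R}$, $C^{\psi}_{\beta,\infty}$ is the class of $f\in C$ such that the series $\sum_{k=1}^{\infty}\frac{1}{\psi(k)}\big(a_k(f)\cos(kx+\frac{\beta\pi}{2})+b_k(f)\sin(kx+\frac{\beta\pi}{2})\big)$ is the Fourier series of some function $\varphi$ with $\operatorname{ess\,sup}_t|\varphi(t)|\leqslant1$; this $\varphi$ is denoted $f^{\psi}_{\beta}$ (the $(\psi,\beta)$-derivative of $f$). Here $\psi(k)$ are the values of the function $\psi$ at natural numbers. For $n,p\in\mathbb{N}$, $1\leqslant p\leqslant n$, and $f\in C$, $U^{\psi}_{n,p}(f;x)=\sum_{k=0}^{n-1}\lambda_{n,p}(k)A_k(f;x)$, where $\lambda_{n,p}(k)=1$ for $0\leqslant k\leqslant n-p$ and $\lambda_{n,p}(k)=1-\frac{\varphi(k)}{\varphi(n)}$ for $n-p+1\leqslant k\leqslant n-1$, with $\varphi(k)=\frac{k-n+p}{\psi(k)}$ (so $\varphi(n)=p/\psi(n)$). $\mathcal{E}(C^{\psi}_{\beta,\infty};U^{\psi}_{n,p})=\sup_{f\in C^{\psi}_{\beta,\infty}}\|f(\cdot)-U^{\psi}_{n,p}(f;\cdot)\|_C$. *)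

(* Defs.v *)
From HB Require Import structures.
From mathcomp Require Import all_boot all_order all_algebra.
From mathcomp Require Import all_classical all_reals all_analysis.
Set Implicit Arguments. Unset Strict Implicit. Unset Printing Implicit Defensive.
Import Order.TTheory GRing.Theory Num.Theory.
Import numFieldNormedType.Exports.
Local Open Scope classical_set_scope.
Local Open Scope ring_scope.

Section Defs.
Variable R : realType.

Definition in_C (f : R -> R) : Prop :=
  continuous f /\ forall x, f (x + 2 * pi) = f x.

Definition normC (g : R -> R) : R := sup [set `|g x| | x in setT].

Definition fa (f : R -> R) (k : nat) : R :=
  pi^-1 * \int[@lebesgue_measure R]_(x in `[0, 2 * pi]) (f x * cos (k%:R * x)).
Definition fb (f : R -> R) (k : nat) : R :=
  pi^-1 * \int[@lebesgue_measure R]_(x in `[0, 2 * pi]) (f x * sin (k%:R * x)).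

Definition Ak (f : R -> R) (k : nat) (x : R) : R :=
  if k == 0%N then fa f 0 / 2
  else fa f k * cos (k%:R * x) + fb f k * sin (k%:R * x).

Definition in_M (psi : R -> R) : Prop :=
  (forall t, 1 <= t -> 0 < psi t) /\
  (forall x y l, 1 <= x -> 1 <= y -> 0 <= l <= 1 ->
     psi (l * x + (1 - l) * y) <= l * psi x + (1 - l) * psi y) /\
  (psi t @[t --> +oo] --> 0).

(* psi^{-1}(y): the (unique, psi being strictly decreasing on [1,+oo))
   s >= 1 with psi s = y *)
Definition psi_inv (psi : R -> R) (y : R) : R :=
  xget 1 [set s | 1 <= s /\ psi s = y].

Definition eta (psi : R -> R) (t : R) : R := psi_inv psi (psi t / 2).

Definition in_F (psi : R -> R) : Prop :=
  in_M psi /\ exists K : R, forall t, 1 < t ->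
    derivable (eta psi) t 1 /\ derive1 (eta psi) t <= K.

(* f in C^psi_{beta,infty}: the series
   sum_k psi(k)^-1 (a_k cos(kx + beta pi/2) + b_k sin(kx + beta pi/2))
   = sum_k [ (a_k cos th + b_k sin th)/psi(k) cos kx
            + (b_k cos th - a_k sin th)/psi(k) sin kx ],   th = beta pi / 2,
   is the Fourier series of some phi with ess sup |phi| <= 1. *)
Definition in_Cpsi (psi : R -> R) (beta : R) (f : R -> R) : Prop :=
  in_C f /\
  exists phi : R -> R,
    measurable_fun setT phi /\
    {ae @lebesgue_measure R, forall t, `|phi t| <= 1} /\
    fa phi 0 = 0 /\
    forall k : nat, (0 < k)%N ->
      fa phi k = (fa f k * cos (beta * pi / 2) + fb f k * sin (beta * pi / 2))
                 / psi k%:R /\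
      fb phi k = (fb f k * cos (beta * pi / 2) - fa f k * sin (beta * pi / 2))
                 / psi k%:R.

Definition varphi (psi : R -> R) (n p k : nat) : R :=
  ((k%:R - n%:R + p%:R) / psi k%:R).
Definition lambda (psi : R -> R) (n p k : nat) : R :=
  if (k <= n - p)%N then 1 else 1 - varphi psi n p k / varphi psi n p n.

Definition U (psi : R -> R) (n p : nat) (f : R -> R) (x : R) : R :=
  \sum_(0 <= k < n) lambda psi n p k * Ak f k x.

Definition Err (psi : R -> R) (beta : R) (n p : nat) : \bar R :=
  ereal_sup [set (normC (fun x => f x - U psi n p f x))%:E
            | f in in_Cpsi psi beta].

Definition Tfun (psi : R -> R) (t : R) : R := eta psi t - t.

Definition Acoef (psi : R -> R) (n p : nat) : R :=
  let T := Tfun psi n%:R in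
  if T <= 1 then ln p%:R
  else if T <= p%:R then ln (p%:R / T)
  else ln (T / p%:R).

End Defs.

(* Main.v *)
Require Import Defs.
From HB Require Import structures.
From mathcomp Require Import all_boot all_order all_algebra.
From mathcomp Require Import all_classical all_reals all_analysis.
From mathcomp Require Import ring lra measurable_realfun.
Import Order.TTheory GRing.Theory Num.Theory.
Import numFieldNormedType.Exports.
Local Open Scope classical_set_scope.
Local Open Scope ring_scope.

(**
  Write th = beta pi / 2 and let phi be the (psi, beta)-derivative of f. The multipliers
  lambda_{n,p} are chosen so that f - U f is psi(n) / pi times the convolution of phi with
  K(t) = sum_k a_k cos(kt + th), where a_k rises linearly from 0 at n - p to 1 at n and equals
  psi(k) / psi(n) for k >= n. Only values psi(k) with k >= n are left, and on both sides of n the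
  coefficients are convex sequences b with b_0 = 1 in the distance j to n. Hence
    K = cos(nt + th) (P_F + P_c) + sin(nt + th) (Q_F - Q_c)
  with P_b = sum b_j cos jt - b_0 / 2 and Q_b = sum b_j sin jt. Summing by parts twice shows
  P_b >= 0 (so that the integral of |P_b| over [0, pi] is pi / 2), Q_b >= 0, and
  Q_b = 1 / (t + 1 / L) up to an error with bounded integral, as soon as b_0 - b_1 = O(1 / L) and
  sum_{j >= L} b_j / j = O(1). The ramp has scale L = p; the tail psi(n + j) / psi(n) has scale
  L = max(T(n), 1), by convexity and the bound on eta'. As |sin| has mean 2 / pi, the integral of
  |sin(nt + th)| |1 / (t + 1 / p) - 1 / (t + 1 / L)| over [0, pi] is
  2 / pi |ln p - ln L| + O(1).

  To stay within trigonometric polynomials, the tail is damped by de la Vallee Poussin weights,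
  which keep it convex. The upper bound then follows from Fejer's theorem, and the lower bound by
  testing K against a smoothed sign of +-sin(nt + th) (of mean zero), whose de la Vallee Poussin
  mean serves as phi.
*)

Set Implicit Arguments.
Unset Strict Implicit.

(** * Calculus with antiderivatives *)

(** Nothing in the hypotheses makes the sum of psi(k) converge (psi(t) = 1/t is allowed), so the
    series of K need not converge absolutely. This forces the finite damped kernel [Ker], estimated
    uniformly in the damping length m: the upper bound lets m tend to infinity, while the lower
    bound fixes m large in terms of n and p and loses only a factor 1 / (1 + 2n/m). The constant 4 /
    pi^2 is a product of three numbers: 1/pi from the convolution, the mean 2/pi of |sin|, and 2 for
    the two halves of [-pi, pi], the negative half being the positive one with -th in place of th.
    The lower bound has one further constraint: the derivative phi must have mean zero. The test
    sign is therefore supported on whole periods of sin(nt + th), on an interval [0, b] with 1 <= b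
    <= pi instead of [0, pi] (and on its mirror image). The main term comes from small t, so the cut
    costs O(1); this is why the oscillation estimate is stated for every such b. *)

Section PointwiseRules.
Context {R : realType}.
Implicit Types (f g : R -> R) (x a b : R).

Lemma cont_cst a : continuous (fun _ : R => a).
Proof. by move=> x; exact: cst_continuous. Qed.

Lemma cont_id : continuous (fun x : R => x).
Proof. by move=> x; exact: cvg_id. Qed.

Lemma cont_add f g : continuous f -> continuous g ->
  continuous (fun x => f x + g x).
Proof. by move=> cf cg x; exact: (continuousD (cf x) (cg x)). Qed.

Lemma cont_opp f : continuous f -> continuous (fun x => - f x).
Proof. by move=> cf x; exact: (continuousN (cf x)). Qed.

Lemma cont_mul f g : continuous f -> continuous g ->
  continuous (fun x => f x * g x).
Proof. by move=> cf cg x; exact: (continuousM (cf x) (cg x)). Qed.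

Lemma cont_exp f n : continuous f -> continuous (fun x => f x ^+ n).
Proof.
move=> cf; elim: n => [|n IH].
  by under eq_fun do rewrite expr0; exact: cont_cst.
by under eq_fun do rewrite exprS; exact: cont_mul.
Qed.

Lemma cont_inv f : (forall x, f x != 0) -> continuous f ->
  continuous (fun x => (f x)^-1).
Proof. by move=> f0 cf x; exact: (continuousV (f0 x) (cf x)). Qed.

Lemma cont_comp f g : continuous f -> continuous g ->
  continuous (fun x => f (g x)).
Proof. by move=> cf cg x; apply: (@continuous_comp _ _ _ g f); [exact: cg|exact: cf]. Qed.

Lemma cont_norm f : continuous f -> continuous (fun x => `|f x|).
Proof. by move=> cf; apply: (cont_comp (f := Num.norm)) => //; exact: norm_continuous. Qed.

Lemma cont_sin f : continuous f -> continuous (fun x => sin (f x)).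
Proof. by move=> cf; apply: cont_comp => //; exact: continuous_sin. Qed.

Lemma cont_cos f : continuous f -> continuous (fun x => cos (f x)).
Proof. by move=> cf; apply: cont_comp => //; exact: continuous_cos. Qed.

Lemma cont_sum (I : Type) (r : seq I) (P : pred I) (F : I -> R -> R) :
  (forall i, continuous (F i)) -> continuous (fun x => \sum_(i <- r | P i) F i x).
Proof.
move=> cF; elim: r => [|i r IH].
  by under eq_fun do rewrite big_nil; exact: cont_cst.
under eq_fun do rewrite big_cons; case: (P i) => //.
exact: cont_add.
Qed.

(* Not a class, so that [apply] leaves derivative goals open instead of running instance search on them. *)
Definition der x f a := is_derive x (1:R) f a.

Lemma drv_eq x f a b : der x f a -> a = b -> der x f b.
Proof. by move=> ? <-. Qed.

Lemma drv_cst a x : der x (fun _ : R => a) 0.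
Proof. exact: is_derive_cst. Qed.

Lemma drv_id x : der x (fun x : R => x) 1.
Proof. exact: is_derive_id. Qed.

Lemma drv_add f g x a b : der x f a -> der x g b ->
  der x (fun x => f x + g x) (a + b).
Proof. by move=> df dg; exact: is_deriveD. Qed.

Lemma drv_opp f x a : der x f a -> der x (fun x => - f x) (- a).
Proof. by move=> df; exact: is_deriveN. Qed.

Lemma drv_mul f g x a b : der x f a -> der x g b ->
  der x (fun x => f x * g x) (f x * b + g x * a).
Proof. by move=> df dg; exact: is_deriveM. Qed.

Lemma drv_inv f x a : f x != 0 -> der x f a ->
  der x (fun x => (f x)^-1) (- ((f x) ^- 2 * a)).
Proof. by move=> f0 df; rewrite -mulNr; exact: is_deriveV. Qed.

Lemma drv_comp f g x a b : der (g x) f a -> der x g b ->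
  der x (fun x => f (g x)) (a * b).
Proof. by move=> df dg; exact: is_derive1_comp. Qed.

Lemma drv_sin g x b : der x g b ->
  der x (fun x => sin (g x)) (cos (g x) * b).
Proof. by move=> dg; apply: drv_comp => //; exact: is_derive_sin. Qed.

Lemma drv_cos g x b : der x g b ->
  der x (fun x => cos (g x)) (- sin (g x) * b).
Proof. by move=> dg; apply: drv_comp => //; exact: is_derive_cos. Qed.

Lemma drv_ln g x b : 0 < g x -> der x g b ->
  der x (fun x => ln (g x)) ((g x)^-1 * b).
Proof. by move=> g0 dg; apply: drv_comp => //; exact: is_derive1_ln. Qed.

Lemma drv_cont f (df : R -> R) : (forall x, der x f (df x)) -> continuous f.
Proof.
move=> d x; have [h _] := d x.
by have /derivable1_diffP/differentiable_continuous := h.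
Qed.

End PointwiseRules.

Ltac cont1 := match goal with
  | |- continuous (fun _ => ?c) => apply: cont_cst
  | |- continuous (fun x => x) => apply: cont_id
  | |- continuous ( *%R ?c) => apply: (cont_mul (@cont_cst _ c) cont_id)
  | |- continuous (+%R ?c) => apply: (cont_add (@cont_cst _ c) cont_id)
  | |- continuous -%R => apply: (cont_opp cont_id)
  | |- continuous (fun x => - @?f x) => apply: cont_opp
  | |- continuous (fun x => @?f x + @?g x) => apply: cont_add
  | |- continuous (fun x => @?f x * @?g x) => apply: cont_mul
  | |- continuous (fun x => @?f x ^+ _) => apply: cont_exp
  | |- continuous (fun x => (@?f x)^-1) => apply: cont_inv
  | |- continuous (fun x => `| @?f x |) => apply: cont_norm
  | |- continuous Num.norm => apply: (cont_norm cont_id)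
  | |- continuous sin => apply: continuous_sin
  | |- continuous cos => apply: continuous_cos
  | |- continuous (fun x => sin (@?f x)) => apply: cont_sin
  | |- continuous (fun x => cos (@?f x)) => apply: cont_cos
  | |- continuous (fun x => bigop _ _ (@?F x)) => apply: cont_sum => ?
  | H : continuous ?f |- continuous (fun x => ?f (@?g x)) => apply: (cont_comp H)
  | |- continuous _ => by []
  end.
Ltac cont := repeat cont1.

Ltac der1 := match goal with
  | |- der _ (fun _ => ?c) _ => apply: drv_cst
  | |- der _ (fun x => x) _ => apply: drv_id
  | |- der _ ( *%R ?c) _ => apply: (drv_mul (@drv_cst _ c _) (drv_id _))
  | |- der _ (+%R ?c) _ => apply: (drv_add (@drv_cst _ c _) (drv_id _))
  | |- der _ GRing.inv _ => apply: (@drv_inv _ (fun x => x)); [|apply: drv_id]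
  | |- der _ sin _ => apply: is_derive_sin
  | |- der _ cos _ => apply: is_derive_cos
  | |- der _ -%R _ => apply: (drv_opp (drv_id _))
  | |- der _ (fun x => - @?f x) _ => apply: drv_opp
  | |- der _ (fun x => @?f x + @?g x) _ => apply: drv_add
  | |- der _ (fun x => @?f x * @?g x) _ => apply: drv_mul
  | |- der _ (fun x => (@?f x)^-1) _ => apply: drv_inv
  | |- der _ (fun x => sin (@?f x)) _ => apply: drv_sin
  | |- der _ (fun x => cos (@?f x)) _ => apply: drv_cos
  | |- der _ (fun x => ln (@?f x)) _ => apply: drv_ln
  end.
(** The rules compute the derivative into an existential variable; what remains is to compare it
    with the expected one, plus the side conditions of inverses and logarithms. *)
Ltac der_tac := apply: drv_eq; [repeat der1 | rewrite /=].

Section Antiderivative.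
Context {R : realType}.
Notation mu := (@lebesgue_measure R).
Implicit Types (f g h k F G : R -> R) (x y a b : R).

(** The mean value theorem for [G - F]. Every comparison of integrals below reduces to this one. *)
Lemma deriv_le F G f g a b : a <= b ->
  (forall x, a <= x <= b -> der x F (f x)) ->
  (forall x, a <= x <= b -> der x G (g x)) ->
  (forall x, a <= x <= b -> f x <= g x) -> F b - F a <= G b - G a.
Proof.
move=> ab dF dG fg.
pose H x := G x - F x.
have dH x : a <= x <= b -> der x H (g x - f x).
  by move=> xab; apply: drv_add; [exact: dG|apply: drv_opp; exact: dF].
have [c cab E] : exists2 c, c \in `[a, b]%R & H b - H a = (g c - f c) * (b - a).
  apply: (@MVT_segment _ H (fun x => g x - f x)) => //.
    move=> x /itvP xab; apply: dH; rewrite !ltW ?xab//.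
  apply: derivable_within_continuous => x /itvP xab.
  by have [] : der x H (g x - f x) by apply: dH; rewrite !xab.
suff : 0 <= H b - H a by rewrite /H; lra.
rewrite E mulr_ge0// subr_ge0//; apply: fg.
by rewrite in_itv in cab.
Qed.

Lemma deriv_eq F G f a b :
  (forall x, der x F (f x)) -> (forall x, der x G (f x)) ->
  F b - F a = G b - G a.
Proof.
move=> dF dG.
have H u v : u <= v -> F v - F u = G v - G u.
  by move=> uv; apply/eqP; rewrite eq_le; apply/andP; split;
    [apply: (@deriv_le _ _ f f)|apply: (@deriv_le _ _ f f)].
by have [/H//|/ltW/H] := leP a b; lra.
Qed.

(** One of the two integrals is always over a point or the empty set, so this is an antiderivative
    on the whole line, based at 0. *)
Definition prim h x : R :=
  \int[mu]_(t in `[0, x]) h t - \int[mu]_(t in `[x, 0]) h t.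

Lemma cont_integrable h a b : continuous h -> mu.-integrable `[a, b] (EFin \o h).
Proof.
move=> ch; apply: continuous_compact_integrable; first exact: segment_compact.
exact: continuous_subspaceT.
Qed.

Lemma Rint_chasles h a b c : continuous h -> a <= b -> b <= c ->
  \int[mu]_(t in `[a, c]) h t = \int[mu]_(t in `[a, b]) h t + \int[mu]_(t in `[b, c]) h t.
Proof.
move=> ch ab bc.
have := @Rintegral_itvB R h (BLeft a) (BRight c) b (cont_integrable a c ch).
rewrite !bnd_simp => /(_ ab bc).
rewrite Rintegral_itv_obnd_cbnd; first lra.
apply: integrableS (cont_integrable b c ch) => //.
by apply: subset_itvr; rewrite bnd_simp.
Qed.

Lemma Rint_empty h a b : b <= a -> \int[mu]_(t in `[a, b]) h t = 0.
Proof.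
rewrite le_eqVlt => /predU1P[->|ba]; first by rewrite set_itv1 Rintegral_set1.
by rewrite set_itv_ge ?Rintegral_set0// bnd_simp -ltNge.
Qed.

Lemma primB h a b : continuous h -> a <= b ->
  prim h b - prim h a = \int[mu]_(t in `[a, b]) h t.
Proof.
move=> ch ab; rewrite /prim.
have [b0|b0] := leP b 0.
  have a0 := le_trans ab b0.
  rewrite (Rint_empty h b0) (Rint_empty h a0) (Rint_chasles ch ab b0); lra.
rewrite (Rint_empty h (ltW b0)).
have [a0|a0] := leP a 0.
  rewrite (Rint_empty h a0) (Rint_chasles ch a0 (ltW b0)); lra.
rewrite (Rint_empty h (ltW a0)) (Rint_chasles ch (ltW a0) ab); lra.
Qed.

Lemma drv_prim h x : continuous h -> der x (prim h) (h x).
Proof.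
move=> ch.
have x1 : x < x + 1 by rewrite ltrDl.
have x2 : x - 1 < x by rewrite ltrBlDr ltrDl.
(* The fundamental theorem needs a left endpoint strictly below x, so it is applied from x - 1;
   [prim] differs from that integral by a constant near x. *)
have [d E] := @continuous_FTC1_closed R h (x - 1) x (x + 1) x1 (cont_integrable _ _ ch) x2 (ch x).
have H : der x (fun y => prim h (x - 1) + \int[mu]_(t in `[x - 1, y]) h t) (h x).
  apply: (@drv_eq _ _ _ (0 + h x)); last exact: add0r.
  apply: drv_add; first exact: drv_cst.
  by apply: DeriveDef => //; rewrite -derive1E; exact: E.
apply: near_eq_is_derive H.
near=> y; rewrite -primB//; first by lra.
near: y; exists 1 => //= y /=; rewrite ltr_distlC => /andP[/ltW].
Unshelve. all: by end_near. Qed.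

End Antiderivative.

Section Integral.
Context {R : realType}.
Notation mu := (@lebesgue_measure R).
Implicit Types (f g h k F G : R -> R) (x y a b c T : R).

(** The integral is oriented and total in its endpoints: additivity, shifts and reflections become
    identities between values of [prim], without order conditions. *)
Definition itg h a b : R := prim h b - prim h a.

Lemma itg_Rint h a b : continuous h -> a <= b ->
  \int[mu]_(t in `[a, b]) h t = itg h a b.
Proof. by move=> ch ab; rewrite -primB. Qed.

Lemma itg_chasles h a b c : itg h a c = itg h a b + itg h b c.
Proof. by rewrite /itg; ring. Qed.

Lemma itg_le_der h F f a b : continuous h -> a <= b ->
  (forall x, a <= x <= b -> der x F (f x)) ->
  (forall x, a <= x <= b -> h x <= f x) -> itg h a b <= F b - F a.
Proof. by move=> ch ab dF hf; apply: (deriv_le ab _ dF hf) => x _; exact: drv_prim. Qed.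

Lemma itg_ge_der h F f a b : continuous h -> a <= b ->
  (forall x, a <= x <= b -> der x F (f x)) ->
  (forall x, a <= x <= b -> f x <= h x) -> F b - F a <= itg h a b.
Proof. by move=> ch ab dF hf; apply: (deriv_le ab dF _ hf) => x _; exact: drv_prim. Qed.

Lemma itg_derT h F a b : continuous h ->
  (forall x, der x F (h x)) -> itg h a b = F b - F a.
Proof. by move=> ch dF; apply: deriv_eq dF => x; exact: drv_prim. Qed.

Lemma itg_le h k a b : continuous h -> continuous k -> a <= b ->
  (forall x, a <= x <= b -> h x <= k x) -> itg h a b <= itg k a b.
Proof.
by move=> ch ck ab hk; apply: (itg_le_der ch ab _ hk) => x _; exact: drv_prim.
Qed.

Lemma eq_itg h k a b : continuous h -> continuous k -> a <= b ->
  (forall x, a <= x <= b -> h x = k x) -> itg h a b = itg k a b.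
Proof.
move=> ch ck ab hk; apply/eqP; rewrite eq_le.
by apply/andP; split; apply: itg_le => // x xab; rewrite hk.
Qed.

Lemma itg_cst c a b : itg (fun=> c) a b = c * (b - a).
Proof.
have -> : c * (b - a) = (c * b) - (c * a) by ring.
apply: (@itg_derT _ (fun x => c * x)); first by cont.
by move=> x; der_tac; rewrite /=; ring.
Qed.

Lemma itg_ge0 h a b : continuous h -> a <= b ->
  (forall x, a <= x <= b -> 0 <= h x) -> 0 <= itg h a b.
Proof.
move=> ch ab h0; rewrite -[leLHS](_ : itg (fun=> 0) a b = 0) ?itg_cst ?mul0r//.
by rewrite -[leLHS](mul0r (b - a)) -itg_cst; apply: itg_le => //; cont.
Qed.

Lemma itgD h k a b : continuous h -> continuous k ->
  itg (fun x => h x + k x) a b = itg h a b + itg k a b.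
Proof.
move=> ch ck.
rewrite (@itg_derT _ (fun x => prim h x + prim k x)); last 2 first.
- by cont.
- by move=> x /=; apply: drv_add; exact: drv_prim.
by rewrite /itg; ring.
Qed.

Lemma itgZ c h a b : continuous h ->
  itg (fun x => c * h x) a b = c * itg h a b.
Proof.
move=> ch.
rewrite (@itg_derT _ (fun x => c * prim h x)); last 2 first.
- by cont.
- by move=> x /=; apply: drv_eq; [apply: drv_mul; [exact: drv_cst|exact: drv_prim]|rewrite /=; ring].
by rewrite /itg; ring.
Qed.

Lemma itgN h a b : continuous h -> itg (fun x => - h x) a b = - itg h a b.
Proof.
move=> ch; rewrite -mulN1r -itgZ//; congr itg; apply/funext => x.
by rewrite mulN1r.
Qed.

Lemma itgB h k a b : continuous h -> continuous k ->
  itg (fun x => h x - k x) a b = itg h a b - itg k a b.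
Proof. by move=> ch ck; rewrite itgD ?itgN//; cont. Qed.

Lemma itg_sum (I : Type) (r : seq I) (P : pred I) (F : I -> R -> R) a b :
  (forall i, continuous (F i)) ->
  itg (fun x => \sum_(i <- r | P i) F i x) a b = \sum_(i <- r | P i) itg (F i) a b.
Proof.
move=> cF; elim: r => [|i r IH].
  rewrite big_nil; under eq_fun do rewrite big_nil.
  by rewrite itg_cst mul0r.
rewrite big_cons; under eq_fun do rewrite big_cons.
by case: (P i) => //; rewrite itgD ?IH//; cont.
Qed.

Lemma itg_norm h a b : continuous h -> a <= b ->
  `|itg h a b| <= itg (fun x => `|h x|) a b.
Proof.
move=> ch ab; rewrite ler_norml -itgN; last by cont.
apply/andP; split; apply: itg_le => //; cont; move=> // x _; last exact: ler_norm.
by rewrite lerNl ler_normr lexx orbT.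
Qed.

Lemma itg_shift h c a b : continuous h ->
  itg (fun x => h (x + c)) a b = itg h (a + c) (b + c).
Proof.
move=> ch; rewrite (@itg_derT _ (fun x => prim h (x + c)))//; first by cont.
move=> x /=; apply: drv_eq; first apply: (@drv_comp _ (prim h)).
- exact: drv_prim.
- by repeat der1.
by rewrite addr0 mulr1.
Qed.

Lemma itg_reflect h a b : continuous h ->
  itg (fun x => h (- x)) a b = itg h (- b) (- a).
Proof.
move=> ch; rewrite (@itg_derT _ (fun x => - prim h (- x))); first by rewrite /itg; ring.
  by cont.
move=> x /=; apply: drv_eq; first apply/drv_opp/(@drv_comp _ (prim h)).
- exact: drv_prim.
- by repeat der1.
by rewrite mulrN1 opprK.
Qed.

Lemma itg_periodic h T a b : continuous h -> (forall x, h (x + T) = h x) ->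
  itg h a (a + T) = itg h b (b + T).
Proof.
move=> ch hT.
suff : itg h a b = itg h (a + T) (b + T) by rewrite /itg; lra.
by rewrite -itg_shift//; congr itg; apply/funext => x; rewrite hT.
Qed.

Lemma periodic_mod h T x : 0 < T -> (forall x, h (x + T) = h x) ->
  exists2 y, 0 <= y <= T & h x = h y.
Proof.
move=> T0 hT.
have hn n y : h (y + n%:R * T) = h y.
  elim: n => [|n IH]; first by rewrite mul0r addr0.
  by rewrite -[RHS]IH -[RHS]hT; congr h; rewrite -natr1; ring.
exists (x - (Num.floor (x / T))%:~R * T).
  have h1 := ge_floor (x / T).
  have h2 := floorD1_gt (x / T).
  rewrite intrD1 in h2.
  have xE : x = x / T * T by rewrite divfK// gt_eqF.
  apply/andP; split.
    by rewrite {1}xE -mulrBl mulr_ge0 ?(ltW T0)// subr_ge0.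
  by rewrite {1}xE -mulrBl ler_piMl ?(ltW T0)//; lra.
case: (Num.floor _) => [n|n].
  by rewrite -[RHS](hn n); congr h; rewrite -[n%:~R]/(n%:R); ring.
by rewrite NegzE -[LHS](hn n.+1); congr h; rewrite intrN -[n.+1%:~R]/(n.+1%:R); ring.
Qed.

Lemma periodic_bounded h T : 0 < T -> continuous h -> (forall x, h (x + T) = h x) ->
  exists2 B, 0 <= B & forall x, `|h x| <= B.
Proof.
move=> T0 ch hT.
have [c _ Hc] := @EVT_max R (fun x => `|h x|) 0 T (ltW T0)
  (continuous_subspaceT (cont_norm ch)).
exists `|h c| => // x; have [y yT ->] := periodic_mod x T0 hT.
by apply: Hc; rewrite in_itv.
Qed.

End Integral.

(** * Trigonometric sums with convex coefficients *)

Section Trigo.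
Context {R : realType}.
Implicit Types (t u x : R).

Lemma pi_lt4 : (pi : R) < 4.
Proof. have := @pihalf_lt2 R; lra. Qed.

Lemma sin_ge_parabola u : 0 <= u -> u - u ^+ 2 / 2 <= sin u.
Proof.
move=> u0.
have cosge x : 0 <= x -> 1 - x <= cos x.
  move=> x0; have := @deriv_le R (fun x => - x) cos (fun=> -1) (fun x => - sin x) 0 x x0.
  rewrite cos0 oppr0 => H.
  suff : - x - 0 <= cos x - 1 by lra.
  apply: H => y _; [by der_tac|exact: is_derive_cos|].
  by have := sin_le1 y; lra.
have := @deriv_le R (fun x => x - x * x / 2) sin (fun x => 1 - x) cos 0 u u0.
rewrite sin0 => H.
suff : u - u * u / 2 - (0 - 0 * 0 / 2) <= sin u - 0 by rewrite expr2; lra.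
apply: H => y /andP[y0 _]; [|exact: is_derive_sin|exact: cosge].
by der_tac; field.
Qed.

Lemma sin_ge_quarter u : 0 <= u <= pi / 2 -> u / 4 <= sin u.
Proof.
move=> /andP[u0 up].
have [u1|u1] := leP u 1.
  have := sin_ge_parabola u0; nra.
(* Beyond 1, monotonicity gives sin u >= sin 1 >= 1/2, and u / 4 < 1/2 because u < 2. *)
have s1 : sin 1 <= sin u.
  have p1 := @pihalf_ge1 R.
  by rewrite le_eqVlt ltr_sin ?u1 ?orbT// in_itv/=; apply/andP; split; lra.
have := sin_ge_parabola (@ler01 R); have := @pihalf_lt2 R; nra.
Qed.

Lemma cos_half t : 1 - cos t = 2 * sin (t / 2) ^+ 2.
Proof.
have -> : cos t = cos (t / 2 + t / 2) by congr cos; field.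
by rewrite cosD; have := cos2Dsin2 (t / 2); rewrite !expr2; lra.
Qed.

Lemma one_sub_cos_ge t : 0 <= t <= pi -> t ^+ 2 / 32 <= 1 - cos t.
Proof.
move=> /andP[t0 tp]; rewrite cos_half.
have : t / 2 / 4 <= sin (t / 2) by apply: sin_ge_quarter; apply/andP; split; lra.
by rewrite !expr2; nra.
Qed.

Lemma one_sub_cos_gt0 t : 0 < t <= pi -> 0 < 1 - cos t.
Proof.
move=> /andP[t0 tp]; apply: (lt_le_trans _ (one_sub_cos_ge (t := t) _)).
  by rewrite divr_gt0// exprn_gt0.
by rewrite tp ltW.
Qed.

Lemma cos_ge_sub_norm x : 1 - `|x| <= cos x.
Proof.
wlog x0 : x / 0 <= x => [H|].
  have [/H//|x0] := leP 0 x.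
  by rewrite -(cosN x) -normrN; apply: H; lra.
rewrite ger0_norm//.
have := @deriv_le R (fun x => - x) cos (fun=> -1) (fun x => - sin x) 0 x x0.
rewrite cos0 oppr0 => H.
suff : - x - 0 <= cos x - 1 by lra.
apply: H => y _; [by der_tac|exact: is_derive_cos|].
by have := sin_le1 y; lra.
Qed.

Lemma norm_mul_cos_sub_sin_le t : 0 <= t -> `|t * cos t - sin t| <= t ^+ 2 / 2.
Proof.
move=> t0.
have dG x : der x (fun x : R => x * x / 2) x by der_tac; field.
have dF x : der x (fun x : R => x * cos x - sin x) (- x * sin x).
  by apply: drv_eq; [apply: drv_add; [apply: drv_mul; [exact: drv_id|exact: is_derive_cos]|
    apply: drv_opp; exact: is_derive_sin]|rewrite /=; ring].
rewrite ler_norml; apply/andP; split.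
  suff : - (t * t / 2) - (- (0 * 0 / 2)) <= (t * cos t - sin t) - (0 * cos 0 - sin 0).
    by rewrite sin0 expr2; lra.
  apply: (@deriv_le R (fun x => - (x * x / 2)) (fun x => x * cos x - sin x)
    (fun x => - x) (fun x => - x * sin x)) => // x.
    by move=> _; exact/drv_opp/dG.
  by move=> /andP[x0 _]; have := sin_le1 x; nra.
suff : (t * cos t - sin t) - (0 * cos 0 - sin 0) <= (t * t / 2) - (0 * 0 / 2).
  by rewrite sin0 expr2; lra.
apply: (@deriv_le R (fun x => x * cos x - sin x) (fun x => (x * x / 2))
    (fun x => - x * sin x) (fun x => x)) => // x.
by move=> /andP[x0 _]; have := sin_geN1 x; nra.
Qed.

(** The derivative of the left-hand expression is t cos t - sin t, so this is the previous lemma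
    integrated once more. *)
Lemma norm_mul_sin_sub_cos_le t : 0 <= t -> `|t * sin t - 2 * (1 - cos t)| <= t ^+ 3 / 6.
Proof.
move=> t0.
have dG x : der x (fun x : R => x * x * x / 6) (x ^+ 2 / 2).
  by der_tac; rewrite expr2; field.
have dF x : der x (fun x : R => x * sin x - 2 * (1 - cos x)) (x * cos x - sin x).
  apply: drv_eq; [apply: drv_add; [apply: drv_mul; [exact: drv_id|exact: is_derive_sin]|
    apply: drv_opp; apply: drv_mul; [exact: drv_cst|
     apply: drv_add; [exact: drv_cst|apply: drv_opp; exact: is_derive_cos]]]|rewrite /=; ring].
rewrite ler_norml; apply/andP; split.
  suff : - (t * t * t / 6) - (- (0 * 0 * 0 / 6)) <=
     (t * sin t - 2 * (1 - cos t)) - (0 * sin 0 - 2 * (1 - cos 0)).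
    by rewrite sin0 cos0 !exprS expr0; lra.
  apply: (@deriv_le R (fun x => - (x * x * x / 6)) (fun x => x * sin x - 2 * (1 - cos x))
    (fun x => - (x ^+ 2 / 2)) (fun x => x * cos x - sin x)) => // x.
    by move=> _; exact/drv_opp/dG.
  by move=> /andP[x0 _]; have := norm_mul_cos_sub_sin_le x0; rewrite ler_norml => /andP[].
suff : (t * sin t - 2 * (1 - cos t)) - (0 * sin 0 - 2 * (1 - cos 0)) <=
   (t * t * t / 6) - (0 * 0 * 0 / 6).
  by rewrite sin0 cos0 !exprS expr0; lra.
apply: (@deriv_le R (fun x => x * sin x - 2 * (1 - cos x)) (fun x => (x * x * x / 6))
    (fun x => x * cos x - sin x) (fun x => (x ^+ 2 / 2))) => // x.
by move=> /andP[x0 _]; have := norm_mul_cos_sub_sin_le x0; rewrite ler_norml => /andP[].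
Qed.

(** The first term is cot(t/2) / 2. Over a common denominator the numerator is at most t^3 / 6 and
    the denominator at least t^3 / 16, which gives 8/3. *)
Lemma half_cot_near_inv t : 0 < t <= pi ->
  `|sin t / (2 * (1 - cos t)) - t^-1| <= 3.
Proof.
move=> tp; have /andP[t0 tpi] := tp.
have c0 := one_sub_cos_gt0 tp.
have -> : sin t / (2 * (1 - cos t)) - t^-1 =
   (t * sin t - 2 * (1 - cos t)) / (t * (2 * (1 - cos t))).
  by field; rewrite gt_eqF// gt_eqF.
have d0 : 0 < t * (2 * (1 - cos t)) by rewrite mulr_gt0// mulr_gt0.
rewrite normrM normfV (gtr0_norm d0) ler_pdivrMr//.
apply: (le_trans (norm_mul_sin_sub_cos_le (ltW t0))).
have : t ^+ 2 / 32 <= 1 - cos t by apply: one_sub_cos_ge; rewrite tpi ltW.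
rewrite -(ler_pM2l t0) !exprS expr0; lra.
Qed.

Lemma norm_sin_natM k t : 0 <= t <= pi -> `|sin (k%:R * t)| <= k%:R * sin t.
Proof.
move=> tp; have s0 := sin_ge0_pi tp.
elim: k => [|k IH]; first by rewrite !mul0r sin0 normr0.
rewrite -natr1 mulrDl mul1r sinD mulrDl mul1r.
apply: (le_trans (ler_normD _ _)); apply: lerD.
  by apply: (le_trans _ IH); rewrite normrM ler_piMr// cos_max.
by rewrite normrM (ger0_norm s0) ler_piMl// cos_max.
Qed.

Lemma sin_natpi k : sin (k%:R * pi) = 0 :> R.
Proof.
elim: k => [|k IH]; first by rewrite mul0r sin0.
by rewrite -natr1 mulrDl mul1r sinD sinpi IH mul0r mulr0 addr0.
Qed.

End Trigo.

(** * Cosine and sine sums with convex coefficients of finite support *)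

Section ConvexSequences.
Context {R : realType}.
Implicit Types (b X : nat -> R) (N : nat) (t : R).

Definition diff2 b j : R := b j - 2 * b j.+1 + b j.+2.

(** Finite support stands in for convergence to 0: with it, convexity alone forces the sequence to
    be nonnegative and decreasing. *)
Definition cvxseq b N :=
  (forall j, (N <= j)%N -> b j = 0) /\ (forall j, 0 <= diff2 b j).

(** Two summations by parts with an arbitrary [X]. Below, [X] is chosen so that its second
    difference is the desired summand, or zero. *)
Lemma abel2 b X N :
  \sum_(j < N) b j * diff2 X j =
  \sum_(j < N) diff2 b j * X j.+2 + b N * (2 * X N.+1 - X N) - b N.+1 * X N.+1
  - (b 0%N * (2 * X 1%N - X 0%N) - b 1%N * X 1%N).
Proof.
elim: N => [|N IH]; first by rewrite !big_ord0; ring.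
by rewrite !big_ord_recr /= IH /diff2; ring.
Qed.

Lemma abel2_supp b X N : (forall j, (N <= j)%N -> b j = 0) ->
  \sum_(j < N) b j * diff2 X j =
  \sum_(j < N) diff2 b j * X j.+2 - (b 0%N * (2 * X 1%N - X 0%N) - b 1%N * X 1%N).
Proof. by move=> b0; rewrite abel2 (b0 N)// (b0 N.+1)//; ring. Qed.

Section Cvx.
Variables (b : nat -> R) (N : nat).
Hypothesis cb : cvxseq b N.
Let b0 := proj1 cb.
Let d0 := proj2 cb.

Lemma cvxseq_decr j : b j.+1 <= b j.
Proof.
(* Induction runs downwards from the end of the support, where the slope is 0; convexity makes
   slopes only more negative to the left. *)
have H k : forall j, (N <= j + k)%N -> b j.+1 <= b j.
  elim: k => [|k IH] i; first by rewrite addn0 => Ni; rewrite !b0// ltnW.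
  rewrite addnS -addSn => /IH; have := d0 i; rewrite /diff2; lra.
by apply: (H N); rewrite leq_addl.
Qed.

Lemma cvxseq_ge0 j : 0 <= b j.
Proof.
have H k : forall j, (N <= j + k)%N -> 0 <= b j.
  elim: k => [|k IH] i; first by rewrite addn0 => Ni; rewrite !b0.
  by rewrite addnS -addSn => /IH; have := cvxseq_decr i; lra.
by apply: (H N); rewrite leq_addl.
Qed.

Lemma cvxseq_le0 j : b j <= b 0%N.
Proof. by elim: j => // j; exact/le_trans/cvxseq_decr. Qed.

Lemma sum_diff2 : \sum_(j < N) diff2 b j = b 0%N - b 1%N.
Proof.
have := abel2_supp (fun=> 1) b0; rewrite big1.
  by under eq_bigr do rewrite mulr1; lra.
by move=> j _; rewrite /diff2; ring.
Qed.

Lemma sum_diff2_natM : \sum_(j < N) diff2 b j * j.+1%:R = b 0%N.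
Proof.
(* A linear [X] has zero second difference; the shift by 1 makes it vanish at 1, so only the
   boundary term [b 0] survives. *)
have := abel2_supp (fun j => j%:R - 1) b0; rewrite big1.
  have -> : \sum_(j < N) diff2 b j * (j.+2%:R - 1) = \sum_(j < N) diff2 b j * j.+1%:R.
    by apply: eq_bigr => j _; rewrite -[j.+2%:R]natr1 addrK.
  lra.
by move=> j _; rewrite /diff2 -!natr1; ring.
Qed.

(** The term j = 0 counts half. For the linear ramp of length N this is the Fejer kernel, normalised
    to integral pi over a period. *)
Definition Pker t : R := \sum_(j < N) b j * cos (j%:R * t) - b 0%N / 2.
Definition Qker t : R := \sum_(j < N) b j * sin (j%:R * t).

(** Here X_j = 1 - cos((j - 1)t), whose second difference is 2(1 - cos t) cos jt. The boundary term
    is exactly what the subtracted [b 0 / 2] absorbs, so a nonnegative combination remains. *)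
Lemma Pker_abel t :
  2 * (1 - cos t) * Pker t = \sum_(j < N) diff2 b j * (1 - cos (j.+1%:R * t)).
Proof.
have := abel2_supp (fun j => 1 - cos ((j%:R - 1) * t)) b0.
have -> : \sum_(j < N) diff2 b j * (1 - cos ((j.+2%:R - 1) * t)) =
          \sum_(j < N) diff2 b j * (1 - cos (j.+1%:R * t)).
  by apply: eq_bigr => j _; rewrite -[j.+2%:R]natr1 addrK.
have -> : \sum_(j < N) b j * diff2 (fun j => 1 - cos ((j%:R - 1) * t)) j =
   2 * (1 - cos t) * \sum_(j < N) b j * cos (j%:R * t).
  rewrite mulr_sumr; apply: eq_bigr => j _; rewrite /diff2 -!natr1.
  have -> : (j%:R + 1 + 1 - 1) * t = j%:R * t + t by ring.
  have -> : (j%:R + 1 - 1) * t = j%:R * t by ring.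
  have -> : (j%:R - 1) * t = j%:R * t - t by ring.
  by rewrite cosB cosD; ring.
rewrite subrr mul0r cos0 sub0r mulN1r cosN /Pker; lra.
Qed.

(** The linear part (j - 1) sin t is added to -sin((j - 1)t) so that X_0 = X_1 = 0: there is no
    boundary term, and each summand is nonnegative by [norm_sin_natM]. *)
Lemma Qker_abel t :
  2 * (1 - cos t) * Qker t =
  \sum_(j < N) diff2 b j * (j.+1%:R * sin t - sin (j.+1%:R * t)).
Proof.
have := abel2_supp (fun j => (j%:R - 1) * sin t - sin ((j%:R - 1) * t)) b0.
have -> : \sum_(j < N) diff2 b j * ((j.+2%:R - 1) * sin t - sin ((j.+2%:R - 1) * t)) =
          \sum_(j < N) diff2 b j * (j.+1%:R * sin t - sin (j.+1%:R * t)).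
  by apply: eq_bigr => j _; rewrite -[j.+2%:R]natr1 addrK.
have -> : \sum_(j < N) b j *
    diff2 (fun j => (j%:R - 1) * sin t - sin ((j%:R - 1) * t)) j =
   2 * (1 - cos t) * \sum_(j < N) b j * sin (j%:R * t).
  rewrite mulr_sumr; apply: eq_bigr => j _; rewrite /diff2 -!natr1.
  have -> : (j%:R + 1 + 1 - 1) * t = j%:R * t + t by ring.
  have -> : (j%:R + 1 - 1) * t = j%:R * t by ring.
  have -> : (j%:R - 1) * t = j%:R * t - t by ring.
  by rewrite sinB sinD; ring.
rewrite subrr !mul0r sin0 !sub0r !mulN1r sinN /Qker => ->; ring.
Qed.

Lemma Pker_ge0 t : 0 <= t <= pi -> 0 <= Pker t.
Proof.
move=> /andP[]; rewrite le_eqVlt => /predU1P[<- _|t0 tp].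
  rewrite /Pker; case: N b0 cb => [b00|n _ _].
    by rewrite big_ord0 b00// mul0r subr0.
  rewrite big_ord_recl /= !mulr0 cos0 mulr1.
  have : 0 <= \sum_(i < n) b (bump 0 i) * cos ((bump 0 i)%:R * 0).
    by apply: sumr_ge0 => i _; rewrite mulr0 cos0 mulr1 cvxseq_ge0.
  have := cvxseq_ge0 0; lra.
have c0 : 0 < 2 * (1 - cos t) by rewrite mulr_gt0// one_sub_cos_gt0// t0.
rewrite -(pmulr_rge0 _ c0) Pker_abel; apply: sumr_ge0 => j _.
by rewrite mulr_ge0// subr_ge0 cos_le1.
Qed.

Lemma Qker_ge0 t : 0 <= t <= pi -> 0 <= Qker t.
Proof.
move=> tp; have /andP[] := tp; rewrite le_eqVlt => /predU1P[<- _|t0 tpi].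
  by rewrite /Qker; apply: sumr_ge0 => i _; rewrite mulr0 sin0 mulr0.
have c0 : 0 < 2 * (1 - cos t) by rewrite mulr_gt0// one_sub_cos_gt0// t0.
rewrite -(pmulr_rge0 _ c0) Qker_abel; apply: sumr_ge0 => j _.
rewrite mulr_ge0// subr_ge0; apply: le_trans (norm_sin_natM _ tp).
exact: ler_norm.
Qed.

(** In [Qker_abel] the linear parts sum to exactly sin t, which produces cot(t/2) / 2. The
    oscillating rest is at most the sum of the second differences, [1 - b 1], and 16 comes from 1 -
    cos t >= t^2 / 32. *)
Lemma Qker_near_inv t : b 0%N = 1 -> 0 < t <= pi ->
  `|Qker t - t^-1| <= 16 * (1 - b 1%N) / t ^+ 2 + 3.
Proof.
move=> b01 tp; have /andP[t0 tpi] := tp.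
have c0 := one_sub_cos_gt0 tp.
set E := \sum_(j < N) diff2 b j * sin (j.+1%:R * t).
have EQ : 2 * (1 - cos t) * Qker t = sin t - E.
  rewrite Qker_abel; under eq_bigr do rewrite mulrBr mulrA.
  by rewrite sumrB -mulr_suml sum_diff2_natM b01 mul1r.
have HE : `|E| <= 1 - b 1%N.
  rewrite -[in leRHS]b01 -sum_diff2; apply: (le_trans (ler_norm_sum _ _ _)).
  by apply: ler_sum => j _; rewrite normrM (ger0_norm (d0 _)) ler_piMr// sin_max.
have -> : Qker t - t^-1 =
  (sin t / (2 * (1 - cos t)) - t^-1) - E / (2 * (1 - cos t)).
  suff -> : Qker t = (sin t - E) / (2 * (1 - cos t)) by ring.
  by rewrite -EQ mulrC mulKf// mulf_neq0// gt_eqF.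
rewrite (le_trans (ler_normB _ _))// addrC lerD ?half_cot_near_inv//.
have d1 : 0 < 2 * (1 - cos t) by rewrite mulr_gt0.
rewrite normrM normfV (gtr0_norm d1) ler_pdivrMr//.
apply: (le_trans HE).
have h : t ^+ 2 / 32 <= 1 - cos t by apply: one_sub_cos_ge; rewrite tpi ltW.
have t2 : 0 < t ^+ 2 by rewrite exprn_gt0.
have b1 : 0 <= 1 - b 1%N by rewrite subr_ge0 -b01 cvxseq_decr.
rewrite -mulrA -[leLHS]mulr1 -!mulrA mulrCA.
rewrite ler_wpM2l// -(ler_pM2l t2) mulr1.
have -> : t ^+ 2 * (16 * ((t ^+ 2)^-1 * (2 * (1 - cos t)))) = 32 * (1 - cos t).
  by field; rewrite gt_eqF.
lra.
Qed.

Lemma cont_Pker : continuous Pker. Proof. by rewrite /Pker; cont. Qed.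
Lemma cont_Qker : continuous Qker. Proof. by rewrite /Qker; cont. Qed.

Lemma itg_cos_nat k : itg (fun t : R => cos (k%:R * t)) 0 pi = if k == 0%N then pi else 0.
Proof.
case: k => [|k] /=.
  under eq_fun do rewrite mul0r cos0.
  by rewrite itg_cst; ring.
rewrite (@itg_derT _ _ (fun t => sin (k.+1%:R * t) / k.+1%:R)); last 2 first.
- by cont.
- by move=> x; der_tac; field; rewrite ?(natr1, nat1r) pnatr_eq0.
by rewrite sin_natpi mulr0 sin0 !mul0r subrr.
Qed.

Lemma itg_Pker : (0 < N)%N -> itg Pker 0 pi = b 0%N * pi / 2.
Proof.
move=> N0; rewrite /Pker itgB; [|by cont|by cont].
rewrite itg_sum; last by move=> i; cont.
have -> : \sum_(i < N) itg (fun x : R => b i * cos (i%:R * x)) 0 pi = b 0%N * pi.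
  case: N N0 => // n _.
  rewrite big_ord_recl big1 ?addr0 => [|i _].
    by rewrite itgZ ?itg_cos_nat//; cont.
  by rewrite itgZ ?itg_cos_nat ?mulr0//; cont.
by rewrite itg_cst; field.
Qed.

(** Integrated termwise, sin jt gives (1 - cos(j/L)) / j. For j < L the bound 1 - cos x <= x makes
    each term at most 1/L; for j >= L the bound 2 leaves the sum of b_j / j. *)
Lemma itg_Qker_le L C2 : b 0%N = 1 -> (0 < L)%N ->
  \sum_(L <= j < N) b j / j%:R <= C2 ->
  itg Qker 0 L%:R^-1 <= 1 + 2 * C2.
Proof.
move=> b01 L0 HC; rewrite /Qker itg_sum; last by move=> i; cont.
have L0' : 0 < L%:R :> R by rewrite ltr0n.
(* At j = 0 both sides are 0, since division by zero yields 0. *)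
have E (j : nat) : itg (fun x : R => b j * sin (j%:R * x)) 0 L%:R^-1 =
     b j * (1 - cos (j%:R / L%:R)) / j%:R.
  rewrite (@itg_derT _ _ (fun t => b j * (1 - cos (j%:R * t)) / j%:R)).
  - by rewrite mulr0 cos0; ring.
  - by cont.
  - move=> x; der_tac; case: j => [|j]; first by rewrite !mul0r sin0; ring.
    by field; rewrite ?(natr1, nat1r) pnatr_eq0.
under eq_bigr do rewrite E.
rewrite -(big_mkord xpredT (fun j => b j * (1 - cos (j%:R / L%:R)) / j%:R)).
have term0 j : 0 <= b j * (1 - cos (j%:R / L%:R)) / j%:R.
  by rewrite divr_ge0// mulr_ge0 ?cvxseq_ge0// subr_ge0 cos_le1.
have S1 M : (M <= L)%N -> \sum_(0 <= j < M) b j * (1 - cos (j%:R / L%:R)) / j%:R <= 1.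
  move=> ML.
  have : \sum_(0 <= j < M) b j * (1 - cos (j%:R / L%:R)) / j%:R <=
         \sum_(0 <= j < M) (L%:R^-1 : R).
    apply: ler_sum_nat => -[|j] _; first by rewrite invr0 mulr0 invr_ge0 ltW.
    rewrite ler_pdivrMr ?ltr0n//.
    have h1 : 1 - cos (j.+1%:R / L%:R : R) <= L%:R^-1 * j.+1%:R.
      have := cos_ge_sub_norm (j.+1%:R / L%:R : R).
      rewrite ger0_norm ?divr_ge0//; lra.
    apply: (le_trans _ h1); rewrite ler_piMl ?subr_ge0 ?cos_le1//.
    by rewrite -b01 cvxseq_le0.
  move=> /le_trans; apply; rewrite big_const_nat subn0 iter_addr_0 -[leLHS]mulr_natl.
  by rewrite ler_pdivrMr// mul1r ler_nat.
have C20 : 0 <= C2.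
  by apply: le_trans HC; apply: sumr_ge0 => j _; rewrite divr_ge0// cvxseq_ge0.
have [NL|/ltnW LN] := leqP N L; first by have := S1 _ NL; lra.
rewrite (big_cat_nat_idem _ (leq0n L) LN)//=; last exact: addr0.
apply: lerD; first exact: S1.
have : \sum_(L <= j < N) b j * (1 - cos (j%:R / L%:R)) / j%:R <=
  \sum_(L <= j < N) 2 * (b j / j%:R).
  apply: ler_sum_nat => j _; rewrite mulrA ler_wpM2r ?invr_ge0//.
  by have := cos_geN1 (j%:R / L%:R : R); have := cvxseq_ge0 j; nra.
rewrite -mulr_sumr => /le_trans; apply; lra.
Qed.

(** A truncation of 1/t at height L. The absolute value only keeps it continuous on the whole line;
    it is used for t >= 0. *)
Definition kap (L : nat) t : R := (`|t| + L%:R^-1)^-1.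

Lemma kap_den_gt0 L t : (0 < L)%N -> 0 < `|t| + L%:R^-1.
Proof. by move=> L0; rewrite ltr_wpDl// invr_gt0 ltr0n. Qed.

Lemma cont_kap L : (0 < L)%N -> continuous (kap L).
Proof. by move=> L0; rewrite /kap; cont => x; rewrite gt_eqF// kap_den_gt0. Qed.

Lemma kap_ge0 L t : (0 < L)%N -> 0 <= kap L t.
Proof. by move=> L0; rewrite invr_ge0 ltW// kap_den_gt0. Qed.

Lemma kap_le L t : (0 < L)%N -> kap L t <= L%:R.
Proof.
move=> L0; rewrite /kap -[leRHS]invrK lef_pV2 ?posrE ?invr_gt0 ?ltr0n ?kap_den_gt0//.
by rewrite lerDr.
Qed.

(** Split at 1/L. Below, both functions are integrated separately, [kap] being at most L on a length
    1/L. Above, the difference is at most c / t^2 + 3 with c of order 1/L, and c / t^2 integrates to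
    at most cL. *)
Lemma itg_Qker_sub_kap L C1 C2 : b 0%N = 1 -> (0 < L)%N ->
  1 - b 1%N <= C1 / L%:R -> \sum_(L <= j < N) b j / j%:R <= C2 ->
  itg (fun t => `|Qker t - kap L t|) 0 pi <= 16 * C1 + 2 * C2 + 15.
Proof.
move=> b01 L0 H1 H2.
have L0' : 0 < L%:R :> R by rewrite ltr0n.
have Li0 : 0 < (L%:R^-1 : R) by rewrite invr_gt0.
have Lpi : (L%:R^-1 : R) <= pi.
  apply: (@le_trans _ _ 1); last by have := @pi_ge2 R; lra.
  by rewrite invf_le1// ler1n.
have cQ := cont_Qker; have ck := cont_kap L0.
rewrite (itg_chasles _ _ L%:R^-1).
have I1 : itg (fun t => `|Qker t - kap L t|) 0 L%:R^-1 <= 2 + 2 * C2.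
  apply: (@le_trans _ _ (itg (fun t => Qker t + L%:R) 0 L%:R^-1)).
    apply: itg_le; [by cont|by cont|exact: ltW|move=> x /andP[x0 x1]].
    apply: (le_trans (ler_normB _ _)); rewrite ger0_norm; last first.
      by rewrite Qker_ge0// x0 (le_trans x1).
    by rewrite lerD2l ger0_norm ?kap_le ?kap_ge0.
  rewrite itgD; [|by cont|by cont].
  rewrite itg_cst subr0 divff ?gt_eqF//.
  by have := itg_Qker_le b01 L0 H2; lra.
have I2 : itg (fun t => `|Qker t - kap L t|) L%:R^-1 pi <= 16 * C1 + 1 + 12.
  (* The first part is the error of [Qker] against 1/t, the second that of [kap] against 1/t, both
     as coefficients of 1 / t^2. *)
  set c := 16 * (1 - b 1%N) + L%:R^-1.
  have c0 : 0 <= c.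
    by rewrite addr_ge0 ?(ltW Li0)// mulr_ge0// subr_ge0 -b01 cvxseq_decr.
  suff J : itg (fun t => `|Qker t - kap L t|) L%:R^-1 pi <=
      (- (c / pi) + 3 * pi) - (- (c * L%:R) + 3 * L%:R^-1).
    have h1 : c * L%:R <= 16 * C1 + 1.
      rewrite /c mulrDl mulVf ?gt_eqF// lerD2r -mulrA ler_wpM2l//.
      by rewrite -ler_pdivlMr.
    have h2 : 0 <= c / pi by rewrite divr_ge0// pi_ge0.
    by have := @pi_lt4 R; lra.
  rewrite -{2}[L%:R]invrK.
  apply: (@itg_le_der R (fun t => `|Qker t - kap L t|) (fun t => - (c / t) + 3 * t)
     (fun t => c / t ^+ 2 + 3) L%:R^-1 pi); [by cont|by []| |].
  - move=> x /andP[x0 _]; have {}x0 := lt_le_trans Li0 x0.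
    by der_tac; [rewrite gt_eqF|field; rewrite gt_eqF].
  - move=> x /andP[Lx xp]; have x0 := lt_le_trans Li0 Lx.
    have q := Qker_near_inv b01 (t := x) (introT andP (conj x0 xp)).
    have k1 : `|x^-1 - kap L x| <= L%:R^-1 / x ^+ 2.
      have D0 : 0 < x + L%:R^-1 by rewrite addr_gt0.
      rewrite /kap (gtr0_norm x0).
      have -> : x^-1 - (x + L%:R^-1)^-1 = L%:R^-1 / (x * (x + L%:R^-1)).
        by field; rewrite ?(gt_eqF x0) ?(gt_eqF D0)//= ?(gt_eqF L0')//;
           rewrite gt_eqF// ltr_wpDl// mulr_ge0// ltW.
      rewrite ger0_norm ?divr_ge0 ?mulr_ge0 ?(ltW Li0) ?(ltW x0) ?(ltW D0)//.
      rewrite ler_wpM2l ?(ltW Li0)// lef_pV2 ?posrE ?mulr_gt0 ?exprn_gt0//.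
      by rewrite expr2 ler_wpM2l ?(ltW x0)// lerDl ltW.
    have -> : Qker x - kap L x = (Qker x - x^-1) + (x^-1 - kap L x) by ring.
    apply: (le_trans (ler_normD _ _)).
    apply: (le_trans (lerD q k1)); rewrite /c mulrDl; lra.
lra.
Qed.

End Cvx.
End ConvexSequences.

(** * The main term of the kernel *)

Section Oscillation.
Context {R : realType}.
Implicit Types (t u x th b : R) (n M p L : nat).

(** The integral of |sin| over a period pi is 2, so subtracting the mean 2/pi makes the primitive
    periodic and hence bounded. *)
Lemma abs_sin_antiderivative : exists S : R -> R, exists2 B : R, 0 <= B &
  (forall u, der u S (`|sin u| - 2 / pi)) /\ forall u, `|S u| <= B.
Proof.
have cs : continuous (fun u : R => `|sin u|) by cont.
pose S (u : R) := prim (fun u : R => `|sin u|) u - 2 / pi * u.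
have dS u : der u S (`|sin u| - 2 / pi).
  apply: drv_eq; first apply: drv_add; first exact: drv_prim.
    by apply: drv_opp; repeat der1.
  by rewrite /= mulr0 addr0 mulr1.
have pi0 := @pi_gt0 R.
have SP u : S (u + pi) = S u.
  suff : itg (fun u : R => `|sin u|) u (u + pi) = 2.
    rewrite /itg /S mulrDr divfK ?gt_eqF//; lra.
  rewrite (itg_periodic _ 0 cs); last by move=> x; rewrite sinDpi normrN.
  rewrite add0r (@eq_itg _ _ sin)//; last 3 first.
  - exact: continuous_sin.
  - exact: pi_ge0.
  - by move=> x xp; rewrite ger0_norm// sin_ge0_pi.
  rewrite (@itg_derT _ sin (fun x => - cos x)); last 2 first.
  - exact: continuous_sin.
  - by move=> x; apply: drv_eq; [apply/drv_opp/is_derive_cos|rewrite opprK].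
  by rewrite cospi cos0; ring.
have [B B0 HB] := periodic_bounded pi0 (drv_cont dS) SP.
by exists S, B.
Qed.

Lemma ln_le_sub1 x : 0 < x -> ln x <= x - 1.
Proof. by move=> x0; have := @le_ln1Dx R (x - 1); rewrite [1 + _]addrC subrK; apply; lra. Qed.

(** Partial integration of the oscillating part of |sin| gains 1/n against the height M of [kap],
    hence the error M/n. This stays bounded as long as M = O(n), which holds for both scales p and
    L. *)
Lemma itg_abs_sin_kap : exists2 C : R, 0 <= C & forall n M th b,
  (0 < n)%N -> (0 < M)%N -> 1 <= b <= pi ->
  `|itg (fun t => `|sin (n%:R * t + th)| * kap M t) 0 b - 2 / pi * ln M%:R|
    <= C * (M%:R / n%:R + 1).
Proof.
have [S [B B0 [dS HB]]] := abs_sin_antiderivative.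
exists (3 * B + 5); first lra.
move=> n M th b n0 M0 /andP[b1 bp].
have n0' : 0 < n%:R :> R by rewrite ltr0n.
have M0' : 0 < M%:R :> R by rewrite ltr0n.
have b0 : 0 <= b by lra.
have pi2 := @pi_ge2 R.
have ip : 0 < 2 / (pi : R) <= 1.
  by rewrite divr_gt0 ?pi_gt0//= ler_pdivrMr ?pi_gt0// mul1r.
set h := fun t => _.
pose k (t : R) := (t + M%:R^-1)^-1.
have Mi0 : 0 < (M%:R^-1 : R) by rewrite invr_gt0.
have kpos t : 0 <= t -> 0 < t + M%:R^-1 by move=> t0; rewrite ltr_wpDl.
have ch : continuous h.
  have ck := @cont_kap R M M0; rewrite /h; cont.
(* [F e] has derivative |sin| k + (e - S) k^2 / n. As |S| <= B, the choices e = B and e = -B give a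
   primitive of a majorant and of a minorant, so the remainder never has to be integrated. *)
pose F (e t : R) := 2 / pi * ln (t + M%:R^-1) + S (n%:R * t + th) * k t / n%:R - e * k t / n%:R.
pose f (e t : R) := `|sin (n%:R * t + th)| * k t + (e - S (n%:R * t + th)) * k t ^+ 2 / n%:R.
have dF e x : 0 <= x <= b -> der x (F e) (f e x).
  move=> /andP[x0 _]; have kx := kpos x x0.
  rewrite /F /f /k.
  apply: drv_eq; first repeat (der1; try (apply: (@drv_comp _ S); first exact: dS)).
  - exact: kx.
  - by rewrite gt_eqF.
  - by rewrite gt_eqF.
  rewrite /=; set c0 := 2 / pi; clearbody c0; field.
  by rewrite !gt_eqF// ltr_wpDl// mulr_ge0// ltW.
have kE t : 0 <= t -> kap M t = k t by move=> t0; rewrite /kap ger0_norm.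
have kb e t : `|e| <= B -> 0 <= t -> `|e * k t / n%:R| <= B * (M%:R / n%:R).
  move=> eB t0; rewrite !normrM (normfV n%:R) (gtr0_norm n0').
  rewrite mulrA ler_wpM2r ?invr_ge0 ?(ltW n0')//.
  apply: ler_pM => //; rewrite -kE// ger0_norm ?kap_ge0// kap_le//.
have sq e t : 0 <= e -> 0 <= e * k t ^+ 2 / n%:R.
  by move=> e0; rewrite divr_ge0 ?ler0n// mulr_ge0// sqr_ge0.
have U : itg h 0 b <= F B b - F B 0.
  apply: (itg_le_der ch b0 (dF B)) => x /andP[x0 _].
  rewrite /h /f kE// lerDl sq// subr_ge0.
  by have := HB (n%:R * x + th); rewrite ler_norml => /andP[].
have Lo : F (- B) b - F (- B) 0 <= itg h 0 b.
  apply: (itg_ge_der ch b0 (dF (- B))) => x /andP[x0 _].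
  rewrite /h /f kE// gerDl -oppr_ge0 -!mulNr sq// oppr_ge0 subr_le0.
  by have := HB (n%:R * x + th); rewrite ler_norml => /andP[].
have l1 : 0 <= ln (b + M%:R^-1) by rewrite ln_ge0// -[leLHS]addr0 lerD// ltW.
have l2 : ln (b + M%:R^-1) <= 5.
  apply: (le_trans (ln_le_sub1 (kpos b b0))).
  have : (M%:R^-1 : R) <= 1 by rewrite invf_le1// ler1n.
  by have := @pi_lt4 R; lra.
have l3 : 0 <= 2 / pi * ln (b + M%:R^-1) <= 5.
  by rewrite mulr_ge0 ?(ltW (andP ip).1)//=; have := ip; nra.
set m := M%:R / n%:R; rewrite -/m in kb.
have m0 : 0 <= m by rewrite divr_ge0.
have NB : `|- B| <= B by rewrite normrN ger0_norm.
have PB : `|B| <= B by rewrite ger0_norm.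
have FE e : F e b - F e 0 - 2 / pi * ln M%:R = 2 / pi * ln (b + M%:R^-1)
   + S (n%:R * b + th) * k b / n%:R - S (n%:R * 0 + th) * k 0 / n%:R
   - e * k b / n%:R + e * k 0 / n%:R.
  rewrite /F; have -> : ln (M%:R : R) = - ln (0 + M%:R^-1) by rewrite add0r lnV ?posrE// opprK.
  by ring.
have := kb _ b (HB (n%:R * b + th)) b0.
have := kb _ 0 (HB (n%:R * 0 + th)) (lexx 0).
have := kb _ b PB b0. have := kb _ 0 PB (lexx 0).
have := FE B; have := FE (- B).
rewrite !ler_norml !mulNr => E1 E2 /andP[? ?] /andP[? ?] /andP[? ?] /andP[? ?].
have Bm : 0 <= B * m by rewrite mulr_ge0.
have p1 : 0 <= B * k 0 / n%:R.
  by rewrite divr_ge0// mulr_ge0// -kE// kap_ge0.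
have p2 : 0 <= B * k b / n%:R.
  by rewrite divr_ge0// mulr_ge0// -kE// kap_ge0.
have -> : (3 * B + 5) * (m + 1) = 3 * (B * m) + 5 * m + 3 * B + 5 by ring.
by apply/andP; split; lra.
Qed.

End Oscillation.

(** * The L1 norm of the kernel, and its integral against a smoothed sign *)

Section Kernel.
Context {R : realType}.
Implicit Types (t u x th b : R) (n p L N : nat) (c : nat -> R).

(** It serves three times: as the rise of the coefficients below n (read backwards from n), as the
    Fejer weights, and as the damping of the tail. *)
Definition ramp p (j : nat) : R := if (j < p)%N then 1 - j%:R / p%:R else 0.

Lemma ramp0 p : (0 < p)%N -> ramp p 0 = 1.
Proof. by move=> p0; rewrite /ramp p0 mul0r subr0. Qed.

Lemma ramp1 p : (0 < p)%N -> 1 - ramp p 1 = p%:R^-1.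
Proof.
case: p => // -[|p] _; rewrite /ramp /=; first by rewrite subr0 invr1.
by rewrite div1r; ring.
Qed.

Lemma cvxseq_ramp p : (0 < p)%N -> cvxseq (ramp p) p.
Proof.
move=> p0; split=> [j pj|j]; first by rewrite /ramp ltnNge pj.
have p0' : 0 < p%:R :> R by rewrite ltr0n.
rewrite /diff2 /ramp; have [h2|h2] := ltnP j.+2 p.
  rewrite (ltnW h2) (ltnW (ltnW h2)) -!natr1.
  by rewrite [leRHS](_ : _ = 0)//; field; rewrite gt_eqF.
have [h1|h1] := ltnP j.+1 p.
  have E : p = j.+2 by apply/eqP; rewrite eqn_leq h1 h2.
  rewrite (ltnW h1) E -!natr1.
  by rewrite [leRHS](_ : _ = 0)//; field; rewrite natr1 natr1 pnatr_eq0.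
have [h0|h0] := ltnP j p; last by rewrite mulr0 subr0 addr0.
by rewrite mulr0 subr0 addr0 subr_ge0 ler_pdivrMr// mul1r ler_nat ltnW.
Qed.

Definition Ker n p th c N t : R :=
  cos (n%:R * t + th) * (Pker (ramp p) p t + Pker c N t)
  + sin (n%:R * t + th) * (Qker (ramp p) p t - Qker c N t).

(** The sign of [kap p t - kap L t]. It is the same for all t, which lets the absolute value be
    taken outside the integral and turn into |ln p - ln L|. *)
Definition sgr p L : R := if (L <= p)%N then 1 else -1.

(* A continuous substitute for the sign of [sin u]. *)
Definition ssin (e u : R) : R := sin u / (`|sin u| + e).

Lemma cont_ssin (e : R) : 0 < e -> continuous (ssin e).
Proof. by move=> e0; rewrite /ssin; cont => x; rewrite gt_eqF// ltr_wpDl. Qed.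

Lemma ssin_le1 (e u : R) : 0 < e -> `|ssin e u| <= 1.
Proof.
move=> e0; have h : 0 < `|sin u| + e by rewrite ltr_wpDl.
by rewrite /ssin normrM normfV (gtr0_norm h) ler_pdivrMr// mul1r lerDl ltW.
Qed.

Lemma ssin_mul_sin (e u : R) : 0 < e -> `|sin u| - e <= ssin e u * sin u.
Proof.
move=> e0; have h : 0 < `|sin u| + e by rewrite ltr_wpDl.
rewrite /ssin mulrAC ler_pdivlMr// -expr2 -real_normK ?num_real//.
by rewrite -subr_sqr gerBl sqr_ge0.
Qed.

Lemma cont_Ker n p th c N : continuous (Ker n p th c N).
Proof.
have := @cont_Pker R (ramp p) p; have := @cont_Pker R c N.
have := @cont_Qker R (ramp p) p; have := @cont_Qker R c N.
by move=> ? ? ? ?; rewrite /Ker; cont.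
Qed.

Lemma sgr_kap p L t : (0 < p)%N -> (0 < L)%N ->
  0 <= sgr p L * (kap p t - kap L t).
Proof.
move=> p0 L0; rewrite /sgr; case: leqP => Lp; rewrite ?mul1r ?mulN1r ?opprB subr_ge0;
  rewrite /kap lef_pV2 ?posrE ?kap_den_gt0// lerD2l lef_pV2 ?posrE ?ltr0n// ler_nat//.
exact: ltnW.
Qed.

Lemma sgr_ln p L : (0 < p)%N -> (0 < L)%N ->
  sgr p L * (ln p%:R - ln L%:R) = `|ln p%:R - ln L%:R|.
Proof.
move=> p0 L0; rewrite /sgr; case: leqP => Lp.
  by rewrite mul1r ger0_norm// subr_ge0 ler_ln ?posrE ?ltr0n// ler_nat.
by rewrite mulN1r ltr0_norm// subr_lt0 ltr_ln ?posrE ?ltr0n// ltr_nat.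
Qed.

Lemma sgr_cases p L : sgr p L = 1 \/ sgr p L = -1.
Proof. by rewrite /sgr; case: ifP => _; [left|right]. Qed.

Lemma itg_le_itv (h : R -> R) (a b d : R) : continuous h -> b <= d ->
  (forall x, b <= x <= d -> 0 <= h x) -> itg h a b <= itg h a d.
Proof. by move=> ch bd h0; rewrite [leRHS](itg_chasles _ _ b) lerDl itg_ge0. Qed.

Lemma Ker_estimates (C1 C2 C3 : R) : exists C : R, forall n p L N c th,
  (0 < p)%N -> (p <= n)%N -> (0 < L)%N -> L%:R <= C3 * n%:R ->
  cvxseq c N -> (0 < N)%N -> c 0%N = 1 -> 1 - c 1%N <= C1 / L%:R ->
  \sum_(L <= j < N) c j / j%:R <= C2 ->
  itg (fun t => `|Ker n p th c N t|) 0 pi <= 2 / pi * `|ln p%:R - ln L%:R| + C /\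
  forall (e b : R), 0 < e -> e * (p%:R + L%:R) <= 1 -> 1 <= b <= pi ->
  2 / pi * `|ln p%:R - ln L%:R| - C <=
  itg (fun t => sgr p L * ssin e (n%:R * t + th) * Ker n p th c N t) 0 b.
Proof.
have [C0 C00 osc] := @itg_abs_sin_kap R.
(* In order: the two cosine sums (pi/2 each, and pi < 4), the sine errors of the ramp (C1 = 1, C2 =
   0) and of the tail, the oscillation errors with p / n <= 1 and L / n <= C3, and the loss from
   smoothing the sign, at most 1 on an interval shorter than 4. *)
exists (4 + (16 + 15) + (16 * C1 + 2 * C2 + 15) + C0 * (1 + 1) + C0 * (C3 + 1) + 4).
move=> n p L N c th p0 pn L0 LC cc N0 c0 c1 HC2.
have n0 : (0 < n)%N by apply: leq_trans pn.
have n0' : 0 < n%:R :> R by rewrite ltr0n.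
have p0' : 0 < p%:R :> R by rewrite ltr0n.
have rp := cvxseq_ramp p0.
have ckp := @cont_kap R p p0; have ckL := @cont_kap R L L0.
have cP := @cont_Pker R (ramp p) p; have cP' := @cont_Pker R c N.
have cQ := @cont_Qker R (ramp p) p; have cQ' := @cont_Qker R c N.
have cK := @cont_Ker n p th c N.
have IP := itg_Pker (ramp p) p0; have IP' := itg_Pker c N0.
rewrite ramp0// mul1r in IP; rewrite c0 mul1r in IP'.
have IR : itg (fun t => `|Qker (ramp p) p t - kap p t|) 0 pi <= 16 * 1 + 2 * 0 + 15.
  apply: itg_Qker_sub_kap => //; first exact: ramp0.
    by rewrite ramp1// div1r.
  by rewrite big_geq.
have IR' := itg_Qker_sub_kap cc c0 L0 c1 HC2.
set RF := fun t => `|Qker (ramp p) p t - kap p t| in IR.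
set RC := fun t => `|Qker c N t - kap L t| in IR'.
have cRF : continuous RF by rewrite /RF; cont.
have cRC : continuous RC by rewrite /RC; cont.
pose s t := `|sin (n%:R * t + th)|.
have cs : continuous s by rewrite /s; cont.
set sg := sgr p L.
have sg1 : `|sg| = 1 by rewrite /sg; case: (sgr_cases p L) => ->; rewrite ?normrN normr1.
pose E t := Pker (ramp p) p t + Pker c N t + RF t + RC t.
have cE : continuous E by rewrite /E; cont.
have E0 t : 0 <= t <= pi -> 0 <= E t.
  move=> tp; rewrite /E; have := Pker_ge0 rp tp; have := Pker_ge0 cc tp.
  have : 0 <= RF t by rewrite /RF.
  have : 0 <= RC t by rewrite /RC.
  lra.
have piB := @pi_lt4 R; have pi2 := @pi_ge2 R; have pi0 := @pi_gt0 R.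
have IE : itg E 0 pi <= 4 + (16 + 15) + (16 * C1 + 2 * C2 + 15).
  rewrite /E itgD; [|by cont|by cont].
  rewrite itgD; [|by cont|by cont].
  by rewrite itgD; [|by cont|by cont]; lra.
pose M t := sg * (s t * kap p t - s t * kap L t).
have cM : continuous M by rewrite /M; cont.
have IM b : 1 <= b <= pi ->
   `|itg M 0 b - 2 / pi * `|ln p%:R - ln L%:R| | <= C0 * (1 + 1) + C0 * (C3 + 1).
  move=> bp; rewrite /M itgZ; last by cont.
  rewrite itgB; [|by cont|by cont].
  have := osc n p th b n0 p0 bp; have := osc n L th b n0 L0 bp.
  rewrite -/s -sgr_ln// -/sg => h1 h2.
  have -> : sg * (itg (fun x => s x * kap p x) 0 b - itg (fun x => s x * kap L x) 0 b)
       - 2 / pi * (sg * (ln p%:R - ln L%:R)) =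
     sg * (itg (fun x => s x * kap p x) 0 b - 2 / pi * ln p%:R) -
     sg * (itg (fun x => s x * kap L x) 0 b - 2 / pi * ln L%:R) by ring.
  apply: (le_trans (ler_normB _ _)); rewrite !normrM sg1 !mul1r.
  apply: lerD.
    apply: (le_trans h2); rewrite ler_wpM2l// lerD2r ler_pdivrMr// mul1r.
    by rewrite ler_nat.
  apply: (le_trans h1); rewrite ler_wpM2l// lerD2r.
  by rewrite ler_pdivrMr.
(* The kernel is [sin * (kap p - kap L)] up to the integrable error [E]. *)
have KE t : 0 <= t <= pi ->
   `|Ker n p th c N t - sin (n%:R * t + th) * (kap p t - kap L t)| <= E t.
  move=> tp; rewrite /Ker.
  have -> : cos (n%:R * t + th) * (Pker (ramp p) p t + Pker c N t)
    + sin (n%:R * t + th) * (Qker (ramp p) p t - Qker c N t)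
    - sin (n%:R * t + th) * (kap p t - kap L t) =
    cos (n%:R * t + th) * (Pker (ramp p) p t + Pker c N t) +
    (sin (n%:R * t + th) * (Qker (ramp p) p t - kap p t) -
     sin (n%:R * t + th) * (Qker c N t - kap L t)) by ring.
  have P0 := Pker_ge0 rp tp; have P0' := Pker_ge0 cc tp.
  apply: (le_trans (ler_normD _ _)).
  have -> : E t = (Pker (ramp p) p t + Pker c N t) + (RF t + RC t) by rewrite /E; ring.
  apply: lerD.
    rewrite normrM (ger0_norm (addr_ge0 P0 P0')); apply: ler_piMl (cos_max _); exact: addr_ge0 P0 P0'.
  apply: (le_trans (ler_normB _ _)); apply: lerD;
    by rewrite normrM ler_piMl// sin_max.
have D0 t := sgr_kap t p0 L0.
rewrite -/sg in D0 *.
have ME t : M t = s t * (sg * (kap p t - kap L t)) by rewrite /M; ring.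
split.
  have : itg (fun t => `|Ker n p th c N t|) 0 pi <= itg (fun t => E t + M t) 0 pi.
    apply: itg_le; [by cont|by cont|exact: ltW|move=> t tp].
    have := KE t tp; set S := sin (n%:R * t + th) * _ => h.
    have -> : Ker n p th c N t = (Ker n p th c N t - S) + S by ring.
    apply: (le_trans (ler_normD _ _)); apply: lerD => //.
    rewrite ME -[sg * _]ger0_norm// [`|sg * _|]normrM sg1 mul1r /S normrM.
    by rewrite /s.
  move=> /le_trans; apply; rewrite itgD//.
  have := IM pi; rewrite lexx andbT ler_norml => /(_ _)/andP[|_]; first lra.
  lra.
move=> e b e0 He bp; have /andP[b1 bpi] := bp.
have csg := @cont_ssin e e0.
have : itg (fun t => M t - E t - 1) 0 b <=
  itg (fun t => sg * ssin e (n%:R * t + th) * Ker n p th c N t) 0 b.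
  apply: itg_le; [by cont|by cont|lra|move=> t /andP[t0 tb]].
  have tp : 0 <= t <= pi by rewrite t0 (le_trans tb).
  have := KE t tp; set S := sin (n%:R * t + th) * _ => h.
  set w := ssin _ _.
  have -> : sg * w * Ker n p th c N t = sg * w * (Ker n p th c N t - S)
     + w * sin (n%:R * t + th) * (sg * (kap p t - kap L t)) by rewrite /S; ring.
  have h1 : - E t <= sg * w * (Ker n p th c N t - S).
    have : `|sg * w * (Ker n p th c N t - S)| <= E t.
      apply: le_trans h; rewrite normrM ler_piMl// normrM sg1 mul1r.
      exact: ssin_le1.
    by rewrite ler_norml => /andP[].
  (* Smoothing loses at most e per unit of |kap p - kap L| <= p + L, hence at most 1 by the choice
     of e. *)
  have h2 : M t - 1 <= w * sin (n%:R * t + th) * (sg * (kap p t - kap L t)).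
    rewrite ME; have d0 := D0 t; set d := sg * _ in d0 *.
    have dle : d <= p%:R + L%:R.
      have h3 := kap_le t p0; have h4 := kap_le t L0.
      have h5 := kap_ge0 t p0; have h6 := kap_ge0 t L0.
      by rewrite /d /sg; case: (sgr_cases p L) => ->; lra.
    have := ssin_mul_sin (n%:R * t + th) e0; rewrite -/w -/(s t).
    nra.
  lra.
apply: le_trans.
rewrite itgB; [|by cont|by cont]; rewrite itgB//.
have : itg E 0 b <= itg E 0 pi.
  by apply: itg_le_itv => // x /andP[bx xp]; apply: E0; rewrite xp andbT; lra.
have := IM b bp; rewrite ler_norml => /andP[h _].
rewrite itg_cst; lra.
Qed.

End Kernel.

(** * The decay rate psi *)

Section DecayRate.
Context {R : realType}.
Variable psi : R -> R.

Section ClassM.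
Hypothesis psiM : in_M psi.
Let psi_gt0 t : 1 <= t -> 0 < psi t.
Proof. by have [+ _] := psiM; apply. Qed.

Lemma psi_three_slopes (x y z : R) : 1 <= x -> x < y -> y < z ->
  (psi y - psi z) * (y - x) <= (psi x - psi y) * (z - y).
Proof.
move=> x1 xy yz; have [_ [cv _]] := psiM.
have zx : 0 < z - x by lra.
have z1 : 1 <= z by lra.
pose l := (z - y) / (z - x).
have l01 : 0 <= l <= 1.
  rewrite divr_ge0 ?ler_pdivrMr//=; lra.
have lE : l * (z - x) = z - y by rewrite divfK ?gt_eqF.
clearbody l; have yE : y = z - l * (z - x) by lra.
have := cv x z l x1 z1 l01.
have -> : l * x + (1 - l) * z = y by lra.
rewrite -(ler_pM2l zx).
have -> : (z - x) * (l * psi x + (1 - l) * psi z) =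
   (z - y) * psi x + (y - x) * psi z by rewrite yE; ring.
by nra.
Qed.

Lemma psi_lt_eventually (e : R) : 0 < e -> exists M : R, forall x, M < x -> psi x < e.
Proof.
move=> e0; have [_ [_ /cvgrPdist_lt]] := psiM.
move=> /(_ e e0) [M [_ HM]]; exists M => x Mx.
by have := HM x Mx; rewrite /= sub0r normrN => /(le_lt_trans (ler_norm _)).
Qed.

(** Were psi x <= psi y, convexity would keep psi at least psi y everywhere beyond y, against the
    limit 0. *)
Lemma psi_decr (x y : R) : 1 <= x -> x < y -> psi y < psi x.
Proof.
move=> x1 xy; rewrite ltNge; apply/negP => xley.
have y1 : 1 <= y by lra.
have [M HM] := psi_lt_eventually (psi_gt0 y1).
have /HM : M < Num.max y M + 1 by rewrite (@le_lt_trans _ _ (Num.max y M)) ?le_max ?lexx ?orbT// ltrDl.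
have yz : y < Num.max y M + 1 by rewrite (@le_lt_trans _ _ (Num.max y M)) ?le_max ?lexx ?orbT// ltrDl.
have := psi_three_slopes x1 xy yz; set z := _ + 1 in yz *.
nra.
Qed.

Lemma psi_nincr (x y : R) : 1 <= x -> x <= y -> psi y <= psi x.
Proof.
move=> x1; rewrite le_eqVlt => /predU1P[->//|xy].
exact/ltW/psi_decr.
Qed.

(** Slopes flatten to the right, so the chord over [1, c] dominates. The gap c > 1 is needed because
    a convex function may jump at the endpoint 1; continuity is thus obtained only for t > 1. *)
Lemma psi_lip (c x y : R) : 1 < c -> c <= x -> x <= y ->
  `|psi x - psi y| <= (psi 1 - psi c) / (c - 1) * (y - x).
Proof.
move=> c1 cx xy.
have x1 : 1 < x by lra.
have d0 : 0 < c - 1 by lra.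
rewrite ger0_norm; last by rewrite subr_ge0 psi_nincr// ltW.
have [->|xny] := eqVneq x y; first by rewrite !subrr mulr0.
have {xny}xy : x < y by rewrite lt_neqAle xny.
rewrite mulrAC ler_pdivlMr//.
have [<-|cnx] := eqVneq c x.
  by apply: psi_three_slopes => //; lra.
have {cnx}cx : c < x by rewrite lt_neqAle cnx.
have h1 := @psi_three_slopes 1 c x (lexx 1) c1 cx.
have h2 := @psi_three_slopes c x y (ltW c1) cx xy.
have xc : 0 < x - c by lra.
rewrite -(ler_pM2r xc).
have h3 : (psi x - psi y) * (x - c) * (c - 1) <= (psi c - psi x) * (y - x) * (c - 1).
  by rewrite ler_wpM2r// ltW.
have h4 : (psi c - psi x) * (c - 1) * (y - x) <= (psi 1 - psi c) * (x - c) * (y - x).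
  by rewrite ler_wpM2r//; lra.
lra.
Qed.

Lemma psi_continuous (x : R) : 1 < x -> {for x, continuous psi}.
Proof.
move=> x1; pose c := (1 + x) / 2.
have c1 : 1 < c by rewrite /c; lra.
have cx : c < x by rewrite /c; lra.
pose K0 := (psi 1 - psi c) / (c - 1).
have K00 : 0 <= K0.
  by rewrite divr_ge0// subr_ge0 ?psi_nincr// ltW.
apply/cvgrPdist_le => /= e e0.
have d0 : 0 < Num.min (x - c) (e / (K0 + 1)).
  rewrite lt_min subr_gt0 cx divr_gt0//; lra.
exists (Num.min (x - c) (e / (K0 + 1))) => //= y Hy.
have : `|x - y| < Num.min (x - c) (e / (K0 + 1)) by exact: Hy.
rewrite lt_min => /andP[h1 h2].
have cy : c <= y by move: h1; rewrite ltr_norml => /andP[]; lra.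
have lip : `|psi x - psi y| <= K0 * `|x - y|.
  have [xy|/ltW yx] := leP x y.
    by rewrite (ler0_norm (x := x - y)) ?subr_le0// opprB; apply: psi_lip => //; exact: ltW.
  by rewrite distrC (ger0_norm (x := x - y)) ?subr_ge0//; apply: psi_lip.
apply: (le_trans lip).
have K1 : 0 < K0 + 1 by lra.
move: h2; rewrite ltr_pdivlMr// => h2.
have : 0 <= `|x - y| by []. nra.
Qed.

Lemma psi_half (t : R) : 1 < t -> exists2 s, t < s & psi s = psi t / 2.
Proof.
move=> t1; have pt := psi_gt0 (ltW t1).
have [|M HM] := @psi_lt_eventually (psi t / 2); first lra.
pose z := Num.max t M + 1.
have tz : t < z by rewrite /z (@le_lt_trans _ _ (Num.max t M)) ?le_max ?lexx ?orbT// ltrDl.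
have Mz : M < z by rewrite /z (@le_lt_trans _ _ (Num.max t M)) ?le_max ?lexx ?orbT// ltrDl.
have [||s sin sE] := @IVT R psi t z (psi t / 2) (ltW tz).
- apply: continuous_in_subspaceT => x /set_mem /=; rewrite in_itv/= => /andP[tx _].
  by apply: psi_continuous; lra.
- by have := HM z Mz; rewrite ge_min le_max => hz; apply/andP; split; apply/orP; [right|left]; lra.
exists s => //; move: sin; rewrite in_itv/= => /andP[ts _].
rewrite lt_neqAle ts andbT; apply/eqP => E; move: sE; rewrite -E; lra.
Qed.

Lemma etaP (t : R) : 1 < t -> t < Defs.eta psi t /\ psi (Defs.eta psi t) = psi t / 2.
Proof.
move=> t1; have [s ts sE] := psi_half t1.
have [e1 eE] : 1 <= Defs.eta psi t /\ psi (Defs.eta psi t) = psi t / 2.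
  (* Existence of a solution rules out the default value 1 of [xget]; monotonicity then places the
     solution to the right of t. *)
  have : exists s, [set s | 1 <= s /\ psi s = psi t / 2] s.
    by exists s; split => //; lra.
  by move=> /(@xgetPex _ 1) [].
split=> //; rewrite ltNge; apply/negP => h.
have := psi_nincr e1 h; have := psi_gt0 (ltW t1); lra.
Qed.

End ClassM.

(** * The scale of the tail, from the bound on the derivative of eta *)

Section ClassF.
Hypothesis psiF : in_F psi.
Let psiM : in_M psi := proj1 psiF.
Let psi_gt0 t : 1 <= t -> 0 < psi t.
Proof. by have [+ _] := psiM; apply. Qed.

Lemma eta_lip : exists2 K : R, 1 <= K &
  forall x y, 1 < x -> x <= y -> Defs.eta psi y - Defs.eta psi x <= K * (y - x).
Proof.
have [_ [K HK]] := psiF.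
exists (Num.max 1 K); first by rewrite le_max lexx.
move=> x y x1 xy; rewrite mulrBr.
have H := @deriv_le R (Defs.eta psi) (fun t => Num.max 1 K * t) (Defs.eta psi)^`()%classic (fun=> Num.max 1 K) x y xy. apply: H.
- move=> t /andP[xt _]; have [|d _] := HK t; first lra.
  by apply: DeriveDef => //; rewrite derive1E.
- by move=> t _; der_tac; ring.
- by move=> t /andP[xt _]; have [|_ d] := HK t; [lra|rewrite le_max d orbT].
Qed.

(** Condensation: each block of q consecutive terms is at most q times its first term. *)
Lemma sum_block_le (u : nat -> R) q A B : (0 < q)%N -> (A <= B)%N ->
  (forall i j, (A <= i)%N -> (i <= j)%N -> u j <= u i) ->
  \sum_(q * A <= j < q * B) u j <= \sum_(A <= i < B) q%:R * u (q * i)%N.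
Proof.
move=> q0 AB mono; elim: B AB => [|B IH].
  by rewrite leqn0 => /eqP ->; rewrite muln0 !big_geq.
rewrite leq_eqVlt => /predU1P[<-|AB]; first by rewrite !big_geq.
rewrite ltnS in AB.
rewrite (@big_cat_nat _ _ _ (q * B)%N)/= ?leq_mul2l ?AB ?leqnSn ?orbT//.
rewrite [X in _ <= X]big_nat_recr//=; apply: lerD; first exact: IH.
have : \sum_(q * B <= j < q * B.+1) u j <= \sum_(q * B <= j < q * B.+1) u (q * B)%N.
  apply: ler_sum_nat => j /andP[h _]; apply: mono => //.
  by apply: (leq_trans AB); rewrite -{1}[B]mul1n leq_mul2r q0 orbT.
by rewrite big_const_nat iter_addr_0 mulnS addnK mulr_natl.
Qed.

(** The three branches of [Acoef] are all |ln p - ln max(T, 1)|, and replacing max(T, 1) by an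
    integer within a factor 2 changes the logarithm by at most 1. *)
Lemma Acoef_scale n p L : (0 < p)%N ->
  (Num.max (Tfun psi n%:R) 1 <= L%:R) -> L%:R <= 2 * Num.max (Tfun psi n%:R) 1 ->
  `|Acoef psi n p - `|ln p%:R - ln L%:R| | <= 1 :> R.
Proof.
move=> p0; rewrite /Acoef; set T := Tfun _ _; set Lm := Num.max T 1 => h1 h2.
have p1 : 1 <= p%:R :> R by rewrite ler1n.
have Lm1 : 1 <= Lm by rewrite le_max lexx orbT.
have LmE : (if T <= 1 then ln p%:R else if T <= p%:R then ln (p%:R / T) else ln (T / p%:R))
   = `|ln p%:R - ln Lm| :> R.
  rewrite /Lm; have [T1|T1] := leP T 1; first by rewrite ln1 subr0 ger0_norm// ln_ge0.
  have T0 : 0 < T by lra.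
  have [Tp|Tp] := leP T p%:R.
    by rewrite ln_div ?posrE ?ltr0n// ger0_norm// subr_ge0 ler_ln ?posrE ?ltr0n.
  by rewrite ln_div ?posrE ?ltr0n// ltr0_norm ?opprB// subr_lt0 ltr_ln ?posrE ?ltr0n.
rewrite LmE.
apply: (le_trans (ler_dist_dist _ _)).
have -> : ln p%:R - ln Lm - (ln p%:R - ln L%:R) = ln L%:R - ln Lm by ring.
have L0 : 0 < L%:R :> R by lra.
have Lm0 : 0 < Lm by lra.
rewrite -ln_div ?posrE// ger0_norm; last by rewrite ln_ge0// ler_pdivlMr// mul1r.
apply: (le_trans (ln_le_sub1 (divr_gt0 L0 Lm0))).
by rewrite lerBlDr ler_pdivrMr//; lra.
Qed.

Definition tailseq n m (j : nat) : R := psi (n + j)%:R / psi n%:R * ramp m j.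

Lemma tailseq_cvx n m : (0 < n)%N -> (0 < m)%N -> cvxseq (tailseq n m) m.
Proof.
move=> n0 m0; have cr := @cvxseq_ramp R m m0; split => [j mj|j].
  by rewrite /tailseq (proj1 cr)// mulr0.
have pn : 0 < psi n%:R by apply: psi_gt0; rewrite ler1n.
pose a i := psi (n + i)%:R / psi n%:R.
have n1 i : 1 <= (n + i)%:R :> R by rewrite ler1n addn_gt0 n0.
have a0 i : 0 <= a i by apply: divr_ge0; apply: ltW => //; exact: psi_gt0.
have lt1 i : (n + i)%:R < (n + i.+1)%:R :> R by rewrite ltr_nat addnS.
have ad i : a i.+1 <= a i.
  by rewrite /a ler_wpM2r ?invr_ge0 ?(ltW pn)// psi_nincr// ltW.
have ac i : 0 <= a i - 2 * a i.+1 + a i.+2.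
  have := psi_three_slopes psiM (n1 i) (lt1 i) (lt1 i.+1).
  rewrite (_ : (n + i.+1)%:R - (n + i)%:R = 1); last by rewrite addnS -natr1; ring.
  rewrite (_ : (n + i.+2)%:R - (n + i.+1)%:R = 1); last by rewrite (addnS n i.+1) -natr1; ring.
  rewrite !mulr1 => h.
  have -> : a i - 2 * a i.+1 + a i.+2 =
     (psi (n + i)%:R - 2 * psi (n + i.+1)%:R + psi (n + i.+2)%:R) / psi n%:R.
    by rewrite /a; ring.
  by rewrite divr_ge0 ?(ltW pn)//; lra.
have rc := proj2 cr j; have r0 := @cvxseq_ge0 _ _ _ cr; have rd := @cvxseq_decr _ _ _ cr.
rewrite /diff2 in rc *.
rewrite /tailseq -!/(a _).
have := ac j; have := a0 j; have := a0 j.+1; have := a0 j.+2.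
have := ad j; have := ad j.+1; have := r0 j; have := r0 j.+1; have := r0 j.+2.
have := rd j; have := rd j.+1.
move: (a j) (a j.+1) (a j.+2) (ramp m j) (ramp m j.+1) (ramp m j.+2) rc => A0 A1 A2 B0 B1 B2.
move=> hb b21 b10 b2 b1 b0 a21 a10 ha2 ha1 ha0 ha.
(* Product of two convex decreasing nonnegative sequences: multiply the two convexity inequalities
   and use (A0 + A2)(B0 + B2) = 2(A0 B0 + A2 B2) - (A0 - A2)(B0 - B2). *)
have e1 : 2 * A1 <= A0 + A2 by lra.
have e2 : 2 * B1 <= B0 + B2 by lra.
have e3 : (2 * A1) * (2 * B1) <= (A0 + A2) * (B0 + B2).
  by apply: ler_pM => //; lra.
have e4 : 0 <= (A0 - A2) * (B0 - B2) by apply: mulr_ge0; lra.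
lra.
Qed.

(** This supplies the hypotheses of [Ker_estimates] for the tail, with constants depending on psi
    only and in particular not on the damping length m. *)
Lemma tailseq_scale : exists (C1 C2 C3 : R), forall n, (2 <= n)%N ->
  exists2 L : nat, (0 < L)%N &
  [/\ L%:R <= C3 * n%:R,
   forall p, (0 < p)%N -> `|Acoef psi n p - `|ln p%:R - ln L%:R| | <= 1 :> R &
   forall m, (L <= m)%N -> 1 - tailseq n m 1 <= C1 / L%:R /\
      \sum_(L <= j < m) tailseq n m j / j%:R <= C2].
Proof.
have [K K1 HK] := eta_lip.
(* For i >= T one has eta(n + i) <= n + T + K i <= n + q i, so stretching the offset i by the factor
   q at least halves psi. *)
have [q q0 qK] : exists2 q : nat, (0 < q)%N & K + 1 <= q%:R.
  exists (Num.truncn K).+2 => //.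
  by have := truncnS_gt K; rewrite -[(_.+2)%:R]natr1 => h; rewrite lerD2r ltW.
exists (2 * K + 3), (2 * q%:R), (Defs.eta psi 2 + K + 1) => n n2.
have n2' : 2 <= n%:R :> R by rewrite (ler_nat _ 2).
have n1 : 1 < n%:R :> R by lra.
have [nT eE] := etaP psiM n1.
set T := Tfun psi n%:R.
have T0 : 0 < T by rewrite /T /Tfun subr_gt0.
pose L := (Num.truncn T).+1.
have TL : T < L%:R by exact: truncnS_gt.
have LT : L%:R <= T + 1 by rewrite /L -natr1 lerD2r truncn_le// ltW.
have L0 : 0 < L%:R :> R by lra.
have pn : 0 < psi n%:R by apply: psi_gt0; lra.
have nj1 j : 1 <= (n + j)%:R :> R by rewrite ler1n addn_gt0 (ltnW n2).
exists L => //; split.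
- have [e2 _] := etaP psiM (t := 2) (ltr1n R 2).
  have h := HK 2 n%:R (ltr1n R 2) n2'.
  apply: (le_trans LT); rewrite /T /Tfun.
  have : 0 <= Defs.eta psi 2 * (n%:R - 1) by apply: mulr_ge0; lra.
  nra.
- move=> p p0; apply: Acoef_scale => //.
    by rewrite ge_max (ltW TL) ler1n.
  rewrite -/T; have [h|h] := leP T 1; lra.
move=> m Lm.
have m0 : (0 < m)%N by apply: leq_trans Lm.
have rle j : ramp m j <= 1 :> R.
  by rewrite /ramp; case: ifP => // _; rewrite lerBlDr lerDl divr_ge0.
split.
  set r := psi (n + 1)%:R / psi n%:R.
  (* Compare slopes over [n, eta(n)] and [eta(n), eta(n + 1)]. On the first psi drops by psi(n) / 2
     over a length T; on the second it drops by (psi(n) - psi(n + 1)) / 2 over a length at most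
     K. *)
  have rT : 1 - r <= K / T.
    have n1' : 1 < (n + 1)%:R :> R by rewrite natrD; lra.
    have [n1T eE1] := etaP psiM n1'.
    have nn : n%:R <= (n + 1)%:R :> R by rewrite ler_nat leq_addr.
    have := HK _ _ n1 nn; rewrite natrD addrAC subrr add0r mulr1 -natrD => hK.
    have ee : Defs.eta psi n%:R < Defs.eta psi (n + 1)%:R.
      rewrite ltNge; apply/negP => h.
      have h1 : 1 <= Defs.eta psi (n + 1)%:R by lra.
      have := psi_nincr psiM h1 h; rewrite eE eE1.
      have : psi (n + 1)%:R < psi n%:R by apply: psi_decr => //; rewrite ?natrD; lra.
      lra.
    have := psi_three_slopes psiM (ltW n1) nT ee.
    rewrite eE eE1 -/T => h.
    rewrite -(ler_pM2r pn) -(ler_pM2r T0).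
    have -> : (1 - r) * psi n%:R * T = (psi n%:R - psi (n + 1)%:R) * T.
      by rewrite /r; field; rewrite gt_eqF.
    have -> : K / T * psi n%:R * T = K * psi n%:R by field; rewrite gt_eqF.
    have hT : Defs.eta psi n%:R - n%:R = T by [].
    rewrite hT in h.
    have : psi n%:R * (Defs.eta psi (n + 1)%:R - Defs.eta psi n%:R) <= psi n%:R * K.
      by rewrite ler_wpM2l// ltW.
    lra.
  have r0 : 0 <= r by apply: divr_ge0; apply: ltW => //; exact: psi_gt0.
  (* If T <= 1 then L <= 2 and the bound is trivial; otherwise L <= 2T. *)
  have r1 : 1 - r <= 2 * (K + 1) / L%:R.
    rewrite ler_pdivlMr//; have [T1|T1] := leP T 1.
      nra.
    have h : (1 - r) * T <= K by rewrite -ler_pdivlMr.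
    have : r <= 1.
      rewrite /r ler_pdivrMr// mul1r psi_nincr//; first exact: ltW.
      by rewrite ler_nat leq_addr.
    nra.
  have m1 : 1 - ramp m 1 <= L%:R^-1 :> R.
    by rewrite ramp1// lef_pV2 ?posrE ?ltr0n// ler_nat.
  rewrite /tailseq -/r.
  have rr : r <= 1.
    rewrite /r ler_pdivrMr// mul1r psi_nincr//; first exact: ltW.
    by rewrite ler_nat leq_addr.
  have -> : (2 * K + 3) / L%:R = 2 * (K + 1) / L%:R + L%:R^-1 by ring.
  have := rle 1%N; nra.
pose u (j : nat) := psi (n + j)%:R / j%:R.
have u0 j : 0 <= u j.
  by apply: divr_ge0 => //; apply: ltW; exact: psi_gt0.
have num (i j : nat) : (L <= i)%N -> (i <= j)%N -> u j <= u i.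
  move=> Li ij; have i0 : (0 < i)%N by apply: leq_trans Li.
  have p1 : 1 <= (n + i)%:R :> R.
    by rewrite natrD; have : 0 <= i%:R :> R by []; lra.
  rewrite /u; apply: ler_pM.
  - by apply/ltW/psi_gt0/(le_trans p1); rewrite ler_nat leq_add2l.
  - by rewrite invr_ge0.
  - by apply: psi_nincr => //; rewrite ler_nat leq_add2l.
  - by rewrite lef_pV2 ?posrE ?ltr0n// ?ler_nat// (leq_trans i0).
pose S := \sum_(L <= j < m) u j.
(* A self-improving bound: the range is cut at qL, the head is at most q psi(n), and condensation
   with the halving property bounds the rest by S / 2. S is a finite sum, so S / 2 can be
   subtracted. *)
have S1 : S <= 2 * q%:R * psi n%:R.
  have Lq : (L <= q * L)%N by rewrite -{1}[L]mul1n leq_mul2r q0 orbT.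
  have mq : (m <= q * m)%N by rewrite -{1}[m]mul1n leq_mul2r q0 orbT.
  have Lqm : (q * L <= q * m)%N by rewrite leq_mul2l Lm orbT.
  have h1 : S <= \sum_(L <= j < q * m) u j.
    by rewrite (@big_cat_nat _ _ _ m L (q * m))//= lerDl sumr_ge0.
  have h2 : \sum_(L <= j < q * m) u j =
      \sum_(L <= j < q * L) u j + \sum_(q * L <= j < q * m) u j.
    by rewrite (@big_cat_nat _ _ _ (q * L) L (q * m)).
  have h3 : \sum_(L <= j < q * L) u j <= q%:R * psi n%:R.
    apply: (@le_trans _ _ (\sum_(L <= j < q * L) (psi n%:R / L%:R))).
      apply: ler_sum_nat => j /andP[Lj _]; apply: (le_trans (num _ _ (leqnn L) Lj)).
      rewrite /u ler_wpM2r ?invr_ge0 ?(ltW L0)//; apply: psi_nincr => //; first lra.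
      by rewrite ler_nat leq_addr.
    rewrite big_const_nat iter_addr_0 -[leLHS]mulr_natr mulrAC ler_pdivrMr//.
    rewrite mulrC -mulrA [psi _ * _]mulrC mulrA ler_wpM2r ?(ltW pn)//.
    by rewrite -natrM ler_nat leq_subr.
  have h4 : \sum_(q * L <= j < q * m) u j <= 2^-1 * S.
    apply: (le_trans (sum_block_le q0 Lm num)).
    rewrite /S mulr_sumr; apply: ler_sum_nat => i /andP[Li _].
    have i0 : 0 < i%:R :> R by rewrite ltr0n (leq_trans _ Li).
    have iT : T <= i%:R by rewrite (le_trans (ltW TL))// ler_nat.
    have -> : q%:R * u (q * i)%N = psi (n + q * i)%:R / i%:R.
      by rewrite /u natrM invfM mulrCA mulVKf// pnatr_eq0 -lt0n.
    rewrite /u mulrA ler_wpM2r ?invr_ge0 ?(ltW i0)//.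
    have ni : 1 < (n + i)%:R :> R by rewrite natrD; lra.
    have [e1 e2] := etaP psiM ni.
    rewrite mulrC -e2; apply: (psi_nincr psiM); first lra.
    have nni : n%:R <= (n + i)%:R :> R by rewrite ler_nat leq_addr.
    have := HK _ _ n1 nni; rewrite !natrD natrM addrAC subrr add0r.
    have -> : Defs.eta psi n%:R = n%:R + T by rewrite /T /Tfun; ring.
    have : (K + 1) * i%:R <= q%:R * i%:R by rewrite ler_wpM2r.
    lra.
  lra.
apply: (@le_trans _ _ (S / psi n%:R)); last by rewrite ler_pdivrMr.
rewrite /S mulr_suml; apply: ler_sum_nat => j _.
have -> : tailseq n m j / j%:R = u j / psi n%:R * ramp m j by rewrite /tailseq /u; ring.
by rewrite ler_piMr// divr_ge0// ltW.
Qed.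

End ClassF.
End DecayRate.

(** * Summation of Fourier series *)

Section TrigSums.
Context {R : realType}.
Implicit Types (t u x th b : R) (n p m k N : nat) (c : nat -> R) (h f : R -> R).

Definition kcoef n p c k : R := if (k <= n)%N then ramp p (n - k) else c (k - n)%N.

Lemma sum_ramp_rev n p (G : nat -> R) : (p <= n)%N ->
  \sum_(k < n) ramp p (n - k) * G (n - k)%N = \sum_(j < p) ramp p j * G j - ramp p 0 * G 0%N.
Proof.
move=> pn.
rewrite (reindex_inj rev_ord_inj) /=.
have -> : \sum_(j < n) ramp p (n - (n - j.+1)) * G (n - (n - j.+1))%N =
          \sum_(j < n) ramp p j.+1 * G j.+1.
  by apply: eq_bigr => j _; rewrite subKn.
have -> : \sum_(j < p) ramp p j * G j = \sum_(j < n.+1) ramp p j * G j.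
  rewrite -!(big_mkord xpredT (fun j => ramp p j * G j)).
  rewrite [RHS](@big_cat_nat _ _ _ p)//=; last exact: leqW.
  rewrite [X in _ + X]big_nat_cond [X in _ + X]big1 ?addr0// => j /andP[/andP[pj _] _].
  by rewrite /ramp ltnNge pj mul0r.
by rewrite big_ord_recl /= addrAC subrr add0r.
Qed.

(** The frequency n occurs once, while both the ramp and the tail contain it with weight 1; the two
    halves subtracted in [Pker] correct this. *)
Lemma Ker_sum n p th c m t : (0 < p)%N -> (p <= n)%N -> (0 < m)%N -> c 0%N = 1 ->
  Ker n p th c m t = \sum_(k < n + m) kcoef n p c k * cos (k%:R * t + th).
Proof.
move=> p0 pn m0 c0; rewrite big_split_ord /=.
have -> : \sum_(i < n) kcoef n p c i * cos (i%:R * t + th) =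
   \sum_(i < n) ramp p (n - i) *
     (cos (n%:R * t + th) * cos ((n - i)%:R * t) + sin (n%:R * t + th) * sin ((n - i)%:R * t)).
  apply: eq_bigr => i _; rewrite /kcoef (ltnW (ltn_ord i)) -cosB; congr (_ * cos _).
  by rewrite natrB ?(ltnW (ltn_ord i))//; ring.
rewrite (@sum_ramp_rev n p (fun j => cos (n%:R * t + th) * cos (j%:R * t)
   + sin (n%:R * t + th) * sin (j%:R * t)))//.
have -> : \sum_(i < m) kcoef n p c (n + i) * cos ((n + i)%:R * t + th) =
   \sum_(i < m) c i * (cos (n%:R * t + th) * cos (i%:R * t)
      - sin (n%:R * t + th) * sin (i%:R * t)).
  apply: eq_bigr => i _; rewrite -cosD; congr (_ * cos _); last by rewrite natrD; ring.
  rewrite /kcoef; case: leqP => h; last by rewrite addKn.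
  have -> : (i : nat) = 0%N by apply/eqP; rewrite -leqn0 -(leq_add2l n) addn0.
  by rewrite addn0 subnn ramp0.
rewrite ramp0// mul0r cos0 sin0 /Ker /Pker /Qker ramp0// c0.
set C := cos (n%:R * t + th); set S := sin (n%:R * t + th).
have -> : \sum_(j < p) ramp p j * (C * cos (j%:R * t) + S * sin (j%:R * t)) =
   C * \sum_(j < p) ramp p j * cos (j%:R * t) + S * \sum_(j < p) ramp p j * sin (j%:R * t).
  by rewrite !mulr_sumr -big_split /=; apply: eq_bigr => j _; ring.
have -> : \sum_(j < m) c j * (C * cos (j%:R * t) - S * sin (j%:R * t)) =
   C * \sum_(j < m) c j * cos (j%:R * t) - S * \sum_(j < m) c j * sin (j%:R * t).
  by rewrite !mulr_sumr -sumrB /=; apply: eq_bigr => j _; ring.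
by field.
Qed.

Definition vpw n m k : R := if (k <= n)%N then 1 else ramp m (k - n).

(** The de la Vallee Poussin kernel as a combination of two Fejer kernels. Its weights are 1 up to
    frequency n, so it does not interfere with the multipliers of U. *)
Definition Vker n m t : R :=
  (n + m)%:R / m%:R * Pker (ramp (n + m)) (n + m) t - n%:R / m%:R * Pker (ramp n) n t.

Lemma Vker_sum n m t : (0 < n)%N -> (0 < m)%N ->
  Vker n m t = \sum_(k < n + m) vpw n m k * cos (k%:R * t) - 2^-1.
Proof.
move=> n0 m0; rewrite /Vker /Pker !ramp0 ?addn_gt0 ?n0//.
have m0' : m%:R != 0 :> R by rewrite pnatr_eq0 -lt0n.
have n0' : n%:R != 0 :> R by rewrite pnatr_eq0 -lt0n.
have nm0' : (n + m)%:R != 0 :> R by rewrite pnatr_eq0 -lt0n addn_gt0 n0.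
have -> : \sum_(j < n) ramp n j * cos (j%:R * t) = \sum_(j < n + m) ramp n j * cos (j%:R * t).
  rewrite big_split_ord /= [X in _ = _ + X]big1 ?addr0// => j _.
  by rewrite /ramp ltnNge leq_addr mul0r.
have -> : \sum_(k < n + m) vpw n m k * cos (k%:R * t) =
  (n + m)%:R / m%:R * \sum_(k < n + m) ramp (n + m) k * cos (k%:R * t)
   - n%:R / m%:R * \sum_(k < n + m) ramp n k * cos (k%:R * t).
  rewrite !mulr_sumr -sumrB; apply: eq_bigr => k _; rewrite !mulrA -mulrBl; congr (_ * _).
  rewrite /vpw /ramp ltn_ord; have [kn|kn] := leqP k n.
    have [kn'|kn'] := ltnP k n.
      by rewrite natrD in nm0' *; field; rewrite m0' n0' nm0'.
    have -> : (k : nat) = n by apply/eqP; rewrite eqn_leq kn kn'.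
    by rewrite natrD in nm0' *; field; rewrite m0' nm0'.
  rewrite [(k < n)%N]ltnNge (ltnW kn) /= ltn_subLR ?(ltnW kn)// ltn_ord natrB ?(ltnW kn)//.
  by rewrite natrD in nm0' *; field; rewrite m0' nm0'.
by rewrite natrD; field.
Qed.

Lemma sin_nat2pi k : sin (k%:R * (2 * pi)) = 0 :> R.
Proof. by rewrite mulrA -(natrM _ k 2) sin_natpi. Qed.

Lemma cos_nat2pi k : cos (k%:R * (2 * pi)) = 1 :> R.
Proof.
have -> : k%:R * (2 * pi) = 2 * (k%:R * pi) :> R by ring.
have := cos_half (2 * (k%:R * pi) : R).
have -> : 2 * (k%:R * pi) / 2 = k%:R * pi :> R by field.
by rewrite sin_natpi expr0n mulr0; lra.
Qed.

Lemma cos_nat_periodic k t : cos (k%:R * (t + 2 * pi)) = cos (k%:R * t).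
Proof. by rewrite mulrDr cosD cos_nat2pi sin_nat2pi mulr1 mulr0 subr0. Qed.

Lemma sin_nat_periodic k t : sin (k%:R * (t + 2 * pi)) = sin (k%:R * t).
Proof. by rewrite mulrDr sinD cos_nat2pi sin_nat2pi mulr1 mulr0 addr0. Qed.

Lemma Pker_periodic (b : nat -> R) N t : Pker b N (t + 2 * pi) = Pker b N t.
Proof. by rewrite /Pker; under eq_bigr do rewrite cos_nat_periodic. Qed.

Lemma Pker_even (b : nat -> R) N t : Pker b N (- t) = Pker b N t.
Proof. by rewrite /Pker; under eq_bigr do rewrite mulrN cosN. Qed.

Lemma itg_period_shift h x : continuous h -> (forall y, h (y + 2 * pi) = h y) ->
  itg (fun t => h (t - x)) 0 (2 * pi) = itg h (- pi) pi.
Proof.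
move=> ch hp; rewrite itg_shift// add0r.
rewrite (_ : 2 * pi - x = - x + 2 * pi); last by ring.
by rewrite (itg_periodic (- x) (- pi) ch hp); congr itg; ring.
Qed.

Lemma itg_sym h : continuous h ->
  itg h (- pi) pi = itg h 0 pi + itg (fun t => h (- t)) 0 pi.
Proof. by move=> ch; rewrite itg_reflect// oppr0 (itg_chasles _ _ 0) addrC. Qed.

Section Fejer.
Variable N : nat.
Hypothesis N0 : (0 < N)%N.
Notation P := (Pker (@ramp R N) N).
Let cr := @cvxseq_ramp R N N0.

Lemma fejer_ge0 t : - pi <= t <= pi -> 0 <= P t.
Proof.
move=> /andP[t1 t2]; have [t0|t0] := leP 0 t; first by apply: (Pker_ge0 cr); rewrite t0.
by rewrite -Pker_even; apply: (Pker_ge0 cr); apply/andP; split; lra.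
Qed.

Lemma itg_fejer : itg P (- pi) pi = pi.
Proof.
have cP := @cont_Pker R (ramp N) N.
rewrite itg_sym//; under eq_fun do rewrite Pker_even.
by rewrite itg_Pker// ramp0//; field.
Qed.

(** In [Pker_abel] the factors 1 - cos are at most 2 and the second differences of the ramp sum to
    1/N. *)
Lemma fejer_decay t : - pi <= t <= pi -> t ^+ 2 * P t <= 32 / N%:R.
Proof.
wlog t0 : t / 0 <= t => [H|/andP[_ tp]].
  have [/H//|/ltW t0] := leP 0 t.
  move=> /andP[t1 t2]; rewrite -Pker_even -sqrrN; apply: H; first lra.
  by apply/andP; split; lra.
have tp' : 0 <= t <= pi by rewrite t0.
have h := one_sub_cos_ge tp'.
have P0 := Pker_ge0 cr tp'.
have E := @Pker_abel R _ _ cr t.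
have : \sum_(j < N) diff2 (ramp N) j * (1 - cos (j.+1%:R * t)) <= 2 / N%:R :> R.
  rewrite mulrC -(@ramp1 R N N0) -[X in _ <= (X - _) * _](@ramp0 R N N0) -(sum_diff2 cr).
  rewrite mulr_suml; apply: ler_sum => j _; rewrite ler_wpM2l//; first exact: (proj2 cr).
  by have := cos_geN1 (j.+1%:R * t); lra.
rewrite -E => h2.
have : t ^+ 2 / 32 * P t <= (1 - cos t) * P t by rewrite ler_wpM2r.
lra.
Qed.

End Fejer.

Lemma fejer_cvg f x (e : R) : in_C f -> 0 < e -> exists N0 : nat, forall N, (N0 <= N)%N ->
  (0 < N)%N -> `|itg (fun t => f t * Pker (ramp N) N (t - x)) 0 (2 * pi) - pi * f x| <= e.
Proof.
move=> [cf pf] e0.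
have pi0 := @pi_gt0 R; have pi4 := @pi_lt4 R.
have tpi0 : 0 < 2 * pi :> R by lra.
have [B B0 HB] := periodic_bounded tpi0 cf pf.
have e8 : 0 < e / 8 by lra.
have /cvgrPdist_le/(_ _ e8) := cf x.
move=> [d /= d0 Hd].
have dd : 0 < d ^+ 2 by rewrite exprn_gt0.
(* With this G the bound |f(t + x) - f(x)| <= e/8 + G t^2 holds for all t, so the integral need not
   be split: e/8 meets the total mass pi < 4, and G t^2 meets the decay 32/N. *)
pose G := 2 * B / d ^+ 2.
have G0 : 0 <= G by rewrite divr_ge0 ?(ltW dd)// mulr_ge0.
have bnd t : `|f (t + x) - f x| <= e / 8 + G * t ^+ 2.
  have t2 : 0 <= G * t ^+ 2 by rewrite mulr_ge0// sqr_ge0.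
  have [td|td] := ltP `|t| d.
    rewrite distrC; apply: (@le_trans _ _ (e / 8)); last by rewrite lerDl.
    by apply: Hd; rewrite /ball_/= opprD addrCA subrr addr0 normrN.
  have h1 : `|f (t + x) - f x| <= 2 * B.
    by apply: (le_trans (ler_normB _ _)); have := HB (t + x); have := HB x; lra.
  apply: (le_trans h1); rewrite -[leLHS]add0r lerD ?(ltW e8)//.
  rewrite /G mulrAC ler_pdivlMr// ler_wpM2l ?mulr_ge0//.
  by rewrite -[t ^+ 2]real_normK ?num_real// lerXn2r ?nnegrE// ltW.
pose N0 := (Num.truncn (G * 32 * 8 * 2 / e)).+1.
exists N0 => N N0N Np.
have Np' : 0 < N%:R :> R by rewrite ltr0n.
have cP := @cont_Pker R (ramp N) N.
have -> : itg (fun t => f t * Pker (ramp N) N (t - x)) 0 (2 * pi) =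
  itg (fun t => f (t + x) * Pker (ramp N) N t) (- pi) pi.
  rewrite -(@itg_period_shift (fun t => f (t + x) * Pker (ramp N) N t) x); last 2 first.
  - by cont.
  - by move=> y; rewrite addrAC pf Pker_periodic.
  by congr itg; apply/funext => t; rewrite subrK.
have -> : pi * f x = itg (fun t => f x * Pker (ramp N) N t) (- pi) pi.
  by rewrite itgZ ?itg_fejer// mulrC.
have pp : - pi <= pi :> R by lra.
rewrite -itgB; [|by cont|by cont].
have cI : continuous (fun x0 => f (x0 + x) * Pker (ramp N) N x0 - f x * Pker (ramp N) N x0).
  by cont.
apply: (le_trans (itg_norm cI pp)).
apply: (@le_trans _ _ (itg (fun t => e / 8 * Pker (ramp N) N t + G * 32 / N%:R) (- pi) pi)).
  apply: itg_le => //; [by cont|by cont|move=> t tp].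
  have P0 := fejer_ge0 Np tp.
  rewrite -mulrBl normrM (ger0_norm P0).
  apply: (@le_trans _ _ ((e / 8 + G * t ^+ 2) * Pker (ramp N) N t)).
    by rewrite ler_wpM2r.
  have : G * (t ^+ 2 * Pker (ramp N) N t) <= G * (32 / N%:R).
    by rewrite ler_wpM2l// fejer_decay.
  lra.
rewrite itgD; [|by cont|by cont].
rewrite itgZ// itg_fejer// itg_cst.
have h : G * 32 / N%:R * 8 <= e / 2.
  rewrite mulrAC ler_pdivrMr//.
  have : G * 32 * 8 * 2 / e <= N%:R.
    by apply: ltW; apply: (lt_le_trans (truncnS_gt _)); rewrite ler_nat.
  by rewrite ler_pdivrMr//; lra.
have h' : 0 <= G * 32 / N%:R by apply: divr_ge0; [apply: mulr_ge0|exact: ltW].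
nra.
Qed.

Lemma Vker_cvg f x n (e : R) : in_C f -> (0 < n)%N -> 0 < e -> exists m0 : nat, forall m,
  (m0 <= m)%N -> (0 < m)%N ->
  `|pi^-1 * itg (fun t => f t * Vker n m (t - x)) 0 (2 * pi) - f x| <= e.
Proof.
move=> fC n0 e0; have [cf pf] := fC.
have pi0 := @pi_gt0 R; have pi2 := @pi_ge2 R.
have e2 : 0 < e / 2 by lra.
have [N0 HN] := @fejer_cvg f x (e / 2) fC e2.
set A := itg (fun t => f t * Pker (ramp n) n (t - x)) 0 (2 * pi).
pose W := e / 2 + `|A - pi * f x|.
have W0 : 0 < W by rewrite ltr_wpDr.
pose m0 := maxn N0 (Num.truncn (n%:R * W * 2 / e)).+1.
exists m0 => m m0m mp.
have mp' : 0 < m%:R :> R by rewrite ltr0n.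
have cn := @cont_Pker R (ramp n) n; have cnm := @cont_Pker R (ramp (n + m)) (n + m).
have nm : (N0 <= n + m)%N.
  by rewrite (leq_trans _ (leq_addl _ _))// (leq_trans _ m0m)// leq_maxl.
have := HN (n + m)%N nm; rewrite addn_gt0 n0 => /(_ isT).
set J := itg _ _ _ => hJ.
have -> : itg (fun t => f t * Vker n m (t - x)) 0 (2 * pi) =
   (n + m)%:R / m%:R * J - n%:R / m%:R * A.
  transitivity (itg (fun t => (n + m)%:R / m%:R * (f t * Pker (ramp (n + m)) (n + m) (t - x))
      - n%:R / m%:R * (f t * Pker (ramp n) n (t - x))) 0 (2 * pi)).
    by congr itg; apply/funext => t; rewrite /Vker; ring.
  rewrite itgB; [|by cont|by cont].
  rewrite itgZ; last by cont.
  by rewrite itgZ; last by cont.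
(* The weights (n + m)/m and -n/m add up to 1. The Fejer error of fixed order n does not shrink, but
   n is fixed and its weight n/m does. *)
have -> : pi^-1 * ((n + m)%:R / m%:R * J - n%:R / m%:R * A) - f x =
   pi^-1 * ((J - pi * f x) + n%:R / m%:R * ((J - pi * f x) - (A - pi * f x))).
  have alg (P J' A' y a d : R) : P != 0 -> d != 0 ->
      P^-1 * ((a + d) / d * J' - a / d * A') - y =
      P^-1 * ((J' - P * y) + a / d * ((J' - P * y) - (A' - P * y))).
    by move=> P0 d0; field; rewrite P0 d0.
  by rewrite natrD alg// gt_eqF.
rewrite normrM ger0_norm ?invr_ge0 ?(ltW pi0)//.
rewrite mulrC ler_pdivrMr//.
apply: (le_trans (ler_normD _ _)).
have hm : n%:R / m%:R * W <= e / 2.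
  rewrite mulrAC ler_pdivrMr//.
  have : n%:R * W * 2 / e <= m%:R.
    apply: ltW; apply: (lt_le_trans (truncnS_gt _)); rewrite ler_nat.
    by rewrite (leq_trans _ m0m)// leq_maxr.
  by rewrite ler_pdivrMr//; lra.
have : `|n%:R / m%:R * ((J - pi * f x) - (A - pi * f x))| <= n%:R / m%:R * W.
  rewrite normrM ger0_norm ?divr_ge0// ler_wpM2l ?divr_ge0//.
  by apply: (le_trans (ler_normB _ _)); rewrite lerD2r.
have : e <= e * pi by rewrite ler_peMr ?(ltW e0)//; lra.
lra.
Qed.

End TrigSums.

(** * Integration against an essentially bounded function *)

Section BoundedPairing.
Context {R : realType}.
Notation mu := (@lebesgue_measure R).
Implicit Types (phi g h : R -> R).

Let D2pi : set R := [set` `[0, 2 * pi]].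
Let mD : measurable D2pi := measurable_itv _.

Definition pairing phi g : R := \int[mu]_(x in `[0, 2 * pi]) (phi x * g x).

(** The bound holds only almost everywhere; truncation to [-1, 1] changes no integral and makes it
    hold everywhere. *)
Lemma pairing_clip phi : measurable_fun setT phi ->
  {ae mu, forall t, `|phi t| <= 1} ->
  exists2 phi' : R -> R, measurable_fun setT phi' /\ (forall t, `|phi' t| <= 1) &
    forall g, continuous g -> pairing phi g = pairing phi' g.
Proof.
move=> mphi aphi.
pose phi' x := Num.max (Num.min (phi x) 1) (-1).
have mphi' : measurable_fun setT phi'.
  by apply: measurable_maxr => //; apply: measurable_minr.
exists phi'.
  split=> // t; rewrite ler_norml /phi' le_max lexx orbT/=.
  rewrite ge_max; apply/andP; split; last lra.
  by rewrite ge_min lexx orbT.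
move=> g cg; rewrite /pairing /Rintegral; congr fine.
have mg : measurable_fun setT g by exact: continuous_measurable_fun.
have mT h : measurable_fun setT h -> measurable_fun D2pi (fun x => (h x * g x)%:E).
  move=> mh; apply/measurable_EFinP; apply: measurable_funM.
    exact: measurable_funS mh.
  exact: measurable_funS mg.
apply: ae_eq_integral; [exact: mD|exact: mT|exact: mT|].
apply: (@filterS _ _ (ae_filter_ringOfSetsType mu)) aphi => x hx _; congr (_ * _)%:E.
move: hx; rewrite ler_norml => /andP[h1 h2].
by rewrite /phi' min_l// max_l.
Qed.

Section Bounded.
Variable phi : R -> R.
Hypothesis mphi : measurable_fun setT phi.
Hypothesis phi1 : forall t, `|phi t| <= 1.

Lemma pairing_integrable g : continuous g ->
  mu.-integrable D2pi (EFin \o (fun x => phi x * g x)).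
Proof.
move=> cg; have ig := cont_integrable 0 (2 * pi) cg.
apply: (le_integrable _ _ _ ig); first exact: mD.
  apply/measurable_EFinP; apply: measurable_funM.
    exact: measurable_funS mphi.
  by apply: measurable_funS (continuous_measurable_fun cg).
by move=> x _; rewrite /= lee_fin normrM ler_piMl.
Qed.

Lemma pairingD g h : continuous g -> continuous h ->
  pairing phi (fun x => g x + h x) = pairing phi g + pairing phi h.
Proof.
move=> cg ch; rewrite -RintegralD//; try exact: pairing_integrable.
by apply: eq_Rintegral => x _; rewrite mulrDr.
Qed.

Lemma pairingZ (c : R) g : continuous g -> pairing phi (fun x => c * g x) = c * pairing phi g.
Proof.
move=> cg; rewrite -RintegralZl//; last exact: pairing_integrable.
by apply: eq_Rintegral => x _; rewrite mulrCA.
Qed.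

Lemma pairing_sum (I : Type) (r : seq I) (P : pred I) (c : I -> R) (G : I -> R -> R) :
  (forall i, continuous (G i)) ->
  pairing phi (fun x => \sum_(i <- r | P i) c i * G i x) =
  \sum_(i <- r | P i) c i * pairing phi (G i).
Proof.
move=> cG; elim: r => [|i r IH].
  rewrite big_nil; under eq_fun do rewrite big_nil.
  rewrite -[RHS](mul0r (pairing phi (fun=> 0))) -pairingZ; last by cont.
  by congr pairing; apply/funext => x; rewrite mul0r.
rewrite big_cons; under eq_fun do rewrite big_cons.
by case: (P i) => //; rewrite pairingD; [rewrite pairingZ// IH|cont|cont].
Qed.

Lemma pairing_le g : continuous g -> `|pairing phi g| <= itg (fun x => `|g x|) 0 (2 * pi).
Proof.
have pi0 := @pi_gt0 R.
have H h : continuous h -> pairing phi h <= itg (fun x => `|h x|) 0 (2 * pi).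
  move=> ch; have ih := pairing_integrable ch.
  have cn : continuous (fun x => `|h x|) by cont.
  rewrite -itg_Rint//; last lra.
  apply: le_Rintegral => //; first exact: cont_integrable.
  move=> x _; apply: (le_trans (ler_norm _)).
  by rewrite normrM ler_piMl.
move=> cg; rewrite ler_norml H// andbT lerNl -mulN1r -pairingZ//.
rewrite (_ : (fun x => `|g x|) = (fun x => `|-1 * g x|)); first by apply: H; cont.
by apply/funext => x; rewrite mulN1r normrN.
Qed.

End Bounded.
End BoundedPairing.

(** * The error of U as a convolution with the kernel *)

Section Multipliers.
Context {R : realType}.
Implicit Types (psi f g phi : R -> R) (x t th beta : R) (n p m k : nat).

Lemma Ker_periodic n p th c m t : (0 < p)%N -> (p <= n)%N -> (0 < m)%N -> c 0%N = 1 ->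
  Ker n p th c m (t + 2 * pi) = Ker n p th c m t :> R.
Proof.
move=> p0 pn m0 c0; rewrite !Ker_sum//; apply: eq_bigr => k _; congr (_ * _).
by rewrite !cosD cos_nat_periodic sin_nat_periodic.
Qed.

Lemma Ker_reflect n p th c m t : (0 < p)%N -> (p <= n)%N -> (0 < m)%N -> c 0%N = 1 ->
  Ker n p th c m (- t) = Ker n p (- th) c m t :> R.
Proof.
move=> p0 pn m0 c0; rewrite !Ker_sum//; apply: eq_bigr => k _; congr (_ * _).
by rewrite -cosN opprD mulrN opprK.
Qed.

Lemma fa_itg f k : continuous f ->
  fa f k = pi^-1 * itg (fun t => f t * cos (k%:R * t)) 0 (2 * pi).
Proof.
move=> cf; rewrite /fa itg_Rint//; first by cont.
by rewrite mulr_ge0// pi_ge0.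
Qed.

Lemma fb_itg f k : continuous f ->
  fb f k = pi^-1 * itg (fun t => f t * sin (k%:R * t)) 0 (2 * pi).
Proof.
move=> cf; rewrite /fb itg_Rint//; first by cont.
by rewrite mulr_ge0// pi_ge0.
Qed.

Lemma Ak_itg f k x : continuous f ->
  Ak f k x = pi^-1 * itg (fun t => f t * cos (k%:R * (t - x))) 0 (2 * pi)
   - (if k == 0%N then fa f 0 / 2 else 0).
Proof.
move=> cf.
have -> : pi^-1 * itg (fun t => f t * cos (k%:R * (t - x))) 0 (2 * pi) =
   fa f k * cos (k%:R * x) + fb f k * sin (k%:R * x).
  rewrite fa_itg// fb_itg// -!mulrA -mulrDr; congr (_ * _).
  rewrite [RHS](_ : _ = cos (k%:R * x) * itg (fun t => f t * cos (k%:R * t)) 0 (2 * pi) +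
    sin (k%:R * x) * itg (fun t => f t * sin (k%:R * t)) 0 (2 * pi)); last by ring.
  rewrite -itgZ; last by cont.
  rewrite -[X in _ = _ + X]itgZ; last by cont.
  rewrite -itgD; [|by cont|by cont].
  by congr itg; apply/funext => t; rewrite mulrBr cosB; ring.
rewrite /Ak; case: eqP => [->|_]; last by rewrite subr0.
by rewrite mul0r cos0 sin0 mulr1 mulr0; field.
Qed.

Lemma vp_mean f n m x : continuous f -> (0 < n)%N -> (0 < m)%N ->
  \sum_(k < n + m) vpw n m k * Ak f k x =
  pi^-1 * itg (fun t => f t * Vker n m (t - x)) 0 (2 * pi).
Proof.
move=> cf n0 m0.
have -> : itg (fun t => f t * Vker n m (t - x)) 0 (2 * pi) =
  itg (fun t => \sum_(k < n + m) vpw n m k * (f t * cos (k%:R * (t - x)))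
     - 2^-1 * (f t * cos (0%:R * t))) 0 (2 * pi).
  congr itg; apply/funext => t; rewrite Vker_sum// mul0r cos0 mulrBr mulr_sumr; congr (_ - _).
    by apply: eq_bigr => k _; ring.
  by ring.
rewrite itgB; [|by cont|by cont].
rewrite itgZ; last by cont.
rewrite itg_sum; last by move=> k; cont.
have -> : \sum_(k < n + m) vpw n m k * Ak f k x =
  \sum_(k < n + m) (vpw n m k * (pi^-1 * itg (fun t => f t * cos (k%:R * (t - x))) 0 (2 * pi))
    - (if (k : nat) == 0%N then fa f 0 / 2 else 0)).
  apply: eq_bigr => k _; rewrite Ak_itg// mulrBr; congr (_ - _).
  by case: eqP => [->|]; rewrite /vpw ?mul1r ?mulr0.
rewrite sumrB mulrBr mulr_sumr; congr (_ - _).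
  apply: eq_bigr => k _; rewrite itgZ; last by cont.
  by rewrite mulrCA.
have N0 : (0 < n + m)%N by rewrite addn_gt0 n0.
rewrite (bigD1 (Ordinal N0)) //= big1 ?addr0.
  by rewrite fa_itg//; ring.
by move=> i /negP h; case: eqP => // i0; case: h; apply/eqP/val_inj.
Qed.

(** Extension by zero, so that U f and the de la Vallee Poussin mean are sums over the same
    range. *)
Definition lamt psi n p k : R := if (k < n)%N then Defs.lambda psi n p k else 0.

Lemma U_lamt psi n p f m x :
  Defs.U psi n p f x = \sum_(k < n + m) lamt psi n p k * Ak f k x.
Proof.
rewrite /Defs.U big_mkord big_split_ord /= [X in _ = _ + X]big1 ?addr0.
  by apply: eq_bigr => k _; rewrite /lamt ltn_ord.
by move=> i _; rewrite /lamt ltnNge leq_addr mul0r.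
Qed.

(** The first identity is what the multipliers are made for: the factor 1/psi(k) in varphi cancels
    psi(k) and leaves a linear rise. The second holds because [lamt] lives on k < n, where the
    damping weight is 1. *)
Lemma kcoef_multiplier psi n p m k : (forall t, 1 <= t -> 0 < psi t) ->
  (0 < p)%N -> (p <= n)%N -> (0 < m)%N -> (0 < k)%N ->
  (vpw n m k - lamt psi n p k) * psi k%:R = psi n%:R * kcoef n p (tailseq psi n m) k /\
  (1 - lamt psi n p k) * vpw n m k = vpw n m k - lamt psi n p k.
Proof.
move=> psi0 p0 pn m0 k0.
have n0 : (0 < n)%N by apply: leq_trans pn.
have pk : psi k%:R != 0 by rewrite gt_eqF// psi0// ler1n.
have pn0 : psi n%:R != 0 by rewrite gt_eqF// psi0// ler1n.
have p0' : p%:R != 0 :> R by rewrite pnatr_eq0 -lt0n.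
rewrite /vpw /lamt /kcoef; case: (ltngtP k n) => kn.
- rewrite mulr1; split=> //.
  rewrite /Defs.lambda; case: leqP => h.
    rewrite subrr mul0r /ramp ltnNge leq_subRL ?(ltnW kn)//.
    by rewrite addnC -leq_subRL// h mulr0.
  have hp : (n - k < p)%N by rewrite ltn_subLR ?(ltnW kn)// addnC -ltn_subLR.
  rewrite /ramp hp.
  rewrite /varphi subrr add0r natrB ?(ltnW kn)//.
  by field; rewrite p0' pk pn0.
- rewrite !subr0 mul1r /tailseq subnKC ?(ltnW kn)//; split=> //.
  by field.
- by rewrite kn subnn ramp0// !subr0 !mulr1 mul1r.
Qed.

Lemma kcoef0 n p c : (0 < p)%N -> (p <= n)%N -> kcoef n p c 0 = 0 :> R.
Proof. by move=> p0 pn; rewrite /kcoef leq0n subn0 /ramp ltnNge pn. Qed.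

Lemma lamt0 psi n p : (0 < n)%N -> lamt psi n p 0 = 1.
Proof. by move=> n0; rewrite /lamt n0 /Defs.lambda leq0n. Qed.

(** It inverts the rotation by th and the division by psi(k) that define the derivative phi,
    recovering the harmonics of f from those of phi. *)
Lemma rotate_coef (a b C S X Y P al be : R) : P != 0 -> C ^+ 2 + S ^+ 2 = 1 ->
  al = (a * C + b * S) / P -> be = (b * C - a * S) / P ->
  a * X + b * Y = P * (al * (X * C + Y * S) + be * (Y * C - X * S)).
Proof.
move=> P0 cs -> ->.
have -> : P * ((a * C + b * S) / P * (X * C + Y * S) + (b * C - a * S) / P * (Y * C - X * S))
   = (a * X + b * Y) * (C ^+ 2 + S ^+ 2) by field.
by rewrite cs mulr1.
Qed.

Lemma vp_error psi beta n p m f x : (forall t, 1 <= t -> 0 < psi t) ->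
  (0 < p)%N -> (p <= n)%N -> (0 < m)%N -> in_Cpsi psi beta f ->
  `|\sum_(k < n + m) vpw n m k * Ak f k x - Defs.U psi n p f x| <=
  psi n%:R / pi * itg (fun t => `|Ker n p (beta * pi / 2) (tailseq psi n m) m t|) (- pi) pi.
Proof.
move=> psi0 p0 pn m0 [[cf pf] [phi0 [mphi0 [aphi0 [_ Hphi0]]]]].
have n0 : (0 < n)%N by apply: leq_trans pn.
have pn0 : 0 < psi n%:R by apply: psi0; rewrite ler1n.
have c0 : tailseq psi n m 0 = 1.
  by rewrite /tailseq addn0 divff ?gt_eqF// mul1r ramp0.
have [phi [mphi phi1] E] := pairing_clip mphi0 aphi0.
set th := beta * pi / 2 in Hphi0 *.
have Hphi k : (0 < k)%N -> pi^-1 * pairing phi (fun x => cos (k%:R * x)) =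
     (fa f k * cos th + fb f k * sin th) / psi k%:R /\
   pi^-1 * pairing phi (fun x => sin (k%:R * x)) =
     (fb f k * cos th - fa f k * sin th) / psi k%:R.
  by move=> k0; have [<- <-] := Hphi0 k k0; rewrite /fa /fb -!E; [|cont|cont].
rewrite (U_lamt psi n p f m x) -sumrB.
have term (k : nat) : vpw n m k * Ak f k x - lamt psi n p k * Ak f k x =
  psi n%:R / pi * (kcoef n p (tailseq psi n m) k *
     pairing phi (fun t => cos (k%:R * (t - x) + th))).
  rewrite -mulrBl; case: (posnP k) => [->|k0].
    by rewrite lamt0// kcoef0// /vpw leq0n subrr !mul0r mulr0.
  have [cE _] := kcoef_multiplier psi0 p0 pn m0 k0.
  have [H1 H2] := Hphi k k0.
  have pk : psi k%:R != 0 by rewrite gt_eqF// psi0// ler1n.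
  have cs : cos th ^+ 2 + sin th ^+ 2 = 1 by exact: cos2Dsin2.
  have -> : Ak f k x = psi k%:R * (pi^-1 * pairing phi (fun t => cos (k%:R * (t - x) + th))).
    rewrite /Ak (gtn_eqF k0) (rotate_coef (cos (k%:R * x)) (sin (k%:R * x)) pk cs H1 H2).
    congr (_ * _); rewrite -!mulrA -mulrDr; congr (_ * _).
    rewrite mulrC -pairingZ//; last by cont.
    rewrite [X in _ + X]mulrC -pairingZ//; last by cont.
    rewrite -pairingD//; [|by cont|by cont].
    congr pairing; apply/funext => t; rewrite mulrBr cosD cosB sinB.
    by ring.
  rewrite [LHS]mulrA cE; ring.
under eq_bigr do rewrite term.
rewrite -mulr_sumr -pairing_sum//; last by move=> k; cont.
have pi0 := @pi_gt0 R.
rewrite normrM ger0_norm; last by rewrite divr_ge0// ltW.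
rewrite ler_wpM2l ?divr_ge0 ?(ltW pi0) ?(ltW pn0)//.
have cK := @cont_Ker R n p th (tailseq psi n m) m.
have -> : (fun t => \sum_(k < n + m) kcoef n p (tailseq psi n m) k *
    cos (k%:R * (t - x) + th)) = (fun t => Ker n p th (tailseq psi n m) m (t - x)).
  by apply/funext => t; rewrite Ker_sum.
have cKx : continuous (fun t => Ker n p th (tailseq psi n m) m (t - x)) by cont.
apply: (le_trans (pairing_le mphi phi1 cKx)).
rewrite (@itg_period_shift R (fun t => `|Ker n p th (tailseq psi n m) m t|) x)//.
  by cont.
by move=> y; rewrite Ker_periodic.
Qed.

End Multipliers.

(** * Trigonometric polynomials and the lower bound *)

Section TrigPolynomials.
Context {R : realType}.
Implicit Types (x t z : R) (al be : nat -> R) (j k M : nat).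

Lemma itg_cos_full z : z != 0 -> sin (z * (2 * pi)) = 0 ->
  itg (fun x : R => cos (z * x)) 0 (2 * pi) = 0.
Proof.
move=> z0 s0; rewrite (@itg_derT _ _ (fun x => sin (z * x) / z)).
- by rewrite s0 mulr0 sin0 mul0r subrr.
- by cont.
- by move=> x; der_tac; field.
Qed.

Lemma itg_sin_full z : cos (z * (2 * pi)) = 1 ->
  itg (fun x : R => sin (z * x)) 0 (2 * pi) = 0.
Proof.
have [->|z0] := eqVneq z 0.
  by move=> _; under eq_fun do rewrite mul0r sin0; rewrite itg_cst mul0r.
move=> c1; rewrite (@itg_derT _ _ (fun x => - cos (z * x) / z)).
- by rewrite c1 mulr0 cos0 subrr.
- by cont.
- by move=> x; der_tac; field.
Qed.

Lemma sin_natB2pi j k : sin ((j%:R - k%:R) * (2 * pi)) = 0 :> R.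
Proof. by rewrite mulrBl sinB !sin_nat2pi mul0r mulr0 subrr. Qed.
Lemma cos_natB2pi j k : cos ((j%:R - k%:R) * (2 * pi)) = 1 :> R.
Proof. by rewrite mulrBl cosB !sin_nat2pi !cos_nat2pi mulr0 addr0 mulr1. Qed.
Lemma sin_natD2pi j k : sin ((j%:R + k%:R) * (2 * pi)) = 0 :> R.
Proof. by rewrite -natrD sin_nat2pi. Qed.
Lemma cos_natD2pi j k : cos ((j%:R + k%:R) * (2 * pi)) = 1 :> R.
Proof. by rewrite -natrD cos_nat2pi. Qed.

Lemma itg_sin_cos j k :
  itg (fun x : R => sin (j%:R * x) * cos (k%:R * x)) 0 (2 * pi) = 0.
Proof.
rewrite (_ : (fun x => _) = (fun x : R =>
   2^-1 * (sin ((j%:R - k%:R) * x) + sin ((j%:R + k%:R) * x)))); last first.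
  by apply/funext => x; rewrite mulrBl mulrDl sinB sinD; field.
rewrite itgZ; last by cont.
rewrite itgD; [|by cont|by cont].
by rewrite !itg_sin_full ?cos_natB2pi ?cos_natD2pi// addr0 mulr0.
Qed.

Lemma natD_neq0 j k : (0 < j + k)%N -> j%:R + k%:R != 0 :> R.
Proof. by move=> jk; rewrite -natrD pnatr_eq0 -lt0n. Qed.

Lemma itg_cos_natB j k :
  itg (fun x : R => cos ((j%:R - k%:R) * x)) 0 (2 * pi) = if j == k then 2 * pi else 0.
Proof.
case: eqP => [->|/eqP jk].
  by under eq_fun do rewrite subrr mul0r cos0; rewrite itg_cst; ring.
by rewrite itg_cos_full ?sin_natB2pi// subr_eq0 eqr_nat.
Qed.

Lemma itg_cos_cos j k : (0 < j + k)%N ->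
  itg (fun x : R => cos (j%:R * x) * cos (k%:R * x)) 0 (2 * pi) = if j == k then pi else 0.
Proof.
move=> jk.
rewrite (_ : (fun x => _) = (fun x : R =>
   2^-1 * (cos ((j%:R - k%:R) * x) + cos ((j%:R + k%:R) * x)))); last first.
  by apply/funext => x; rewrite mulrBl mulrDl cosB cosD; field.
rewrite itgZ; last by cont.
rewrite itgD; [|by cont|by cont].
rewrite itg_cos_natB itg_cos_full ?sin_natD2pi ?natD_neq0//.
by case: eqP => _; rewrite addr0 ?mulr0// mulKf.
Qed.

Lemma itg_sin_sin j k : (0 < j + k)%N ->
  itg (fun x : R => sin (j%:R * x) * sin (k%:R * x)) 0 (2 * pi) = if j == k then pi else 0.
Proof.
move=> jk.
rewrite (_ : (fun x => _) = (fun x : R =>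
   2^-1 * (cos ((j%:R - k%:R) * x) - cos ((j%:R + k%:R) * x)))); last first.
  by apply/funext => x; rewrite mulrBl mulrDl cosB cosD; field.
rewrite itgZ; last by cont.
rewrite itgB; [|by cont|by cont].
rewrite itg_cos_natB itg_cos_full ?sin_natD2pi ?natD_neq0//.
by case: eqP => _; rewrite subr0 ?mulr0// mulKf.
Qed.

Definition tpoly M al be x : R :=
  \sum_(k < M) (al k * cos (k%:R * x) + be k * sin (k%:R * x)).

Lemma cont_tpoly M al be : continuous (tpoly M al be).
Proof. by rewrite /tpoly; cont. Qed.

Lemma tpoly_in_C M al be : in_C (tpoly M al be).
Proof.
split; first exact: cont_tpoly.
by move=> x; apply: eq_bigr => k _; rewrite cos_nat_periodic sin_nat_periodic.
Qed.

(** The constant term is excluded because the square of its cosine integrates to 2 pi instead of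
    pi. *)
Lemma fa_tpoly M al be k : al 0%N = 0 ->
  fa (tpoly M al be) k = if (k < M)%N then al k else 0.
Proof.
move=> al0; rewrite fa_itg; last exact: cont_tpoly.
have pi0 : pi != 0 :> R by rewrite gt_eqF// pi_gt0.
have -> : itg (fun t => tpoly M al be t * cos (k%:R * t)) 0 (2 * pi) =
   \sum_(j < M) (if (j : nat) == k then pi * al k else 0).
  under eq_fun do rewrite /tpoly mulr_suml.
  rewrite itg_sum; last by move=> j; cont.
  apply: eq_bigr => j _.
  transitivity (itg (fun x : R => al j * (cos (j%:R * x) * cos (k%:R * x)) +
      be j * (sin (j%:R * x) * cos (k%:R * x))) 0 (2 * pi)).
    by congr itg; apply/funext => x; ring.
  rewrite itgD; [|by cont|by cont].
  rewrite itgZ; last by cont.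
  rewrite itgZ; last by cont.
  rewrite itg_sin_cos mulr0 addr0.
  have [jk|] := posnP (j + k).
    have /andP[/eqP j0 /eqP k0] : ((j : nat) == 0%N) && (k == 0%N) by rewrite -addn_eq0 jk.
    by rewrite k0 j0 eqxx al0 mul0r mulr0.
  move=> jk; rewrite itg_cos_cos//; case: eqP => [->|_]; last by rewrite mulr0.
  by rewrite mulrC.
case: ltnP => kM.
  rewrite (bigD1 (Ordinal kM)) //= eqxx big1 ?addr0 ?mulKf// => i ik.
  by case: eqP => // E; case/eqP: ik; exact: val_inj.
rewrite big1 ?mulr0// => i _; case: eqP => // E.
by have := ltn_ord i; rewrite E ltnNge kM.
Qed.

Lemma fb_tpoly M al be k : be 0%N = 0 ->
  fb (tpoly M al be) k = if (k < M)%N then be k else 0.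
Proof.
move=> be0; rewrite fb_itg; last exact: cont_tpoly.
have pi0 : pi != 0 :> R by rewrite gt_eqF// pi_gt0.
have -> : itg (fun t => tpoly M al be t * sin (k%:R * t)) 0 (2 * pi) =
   \sum_(j < M) (if (j : nat) == k then pi * be k else 0).
  under eq_fun do rewrite /tpoly mulr_suml.
  rewrite itg_sum; last by move=> j; cont.
  apply: eq_bigr => j _.
  transitivity (itg (fun x : R => al j * (sin (k%:R * x) * cos (j%:R * x)) +
      be j * (sin (j%:R * x) * sin (k%:R * x))) 0 (2 * pi)).
    by congr itg; apply/funext => x; ring.
  rewrite itgD; [|by cont|by cont].
  rewrite itgZ; last by cont.
  rewrite itgZ; last by cont.
  rewrite itg_sin_cos mulr0 add0r.
  have [jk|] := posnP (j + k).
    have /andP[/eqP j0 /eqP k0] : ((j : nat) == 0%N) && (k == 0%N) by rewrite -addn_eq0 jk.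
    by rewrite k0 j0 eqxx be0 mul0r mulr0.
  move=> jk; rewrite itg_sin_sin//; case: eqP => [->|_]; last by rewrite mulr0.
  by rewrite mulrC.
case: ltnP => kM.
  rewrite (bigD1 (Ordinal kM)) //= eqxx big1 ?addr0 ?mulKf// => i ik.
  by case: eqP => // E; case/eqP: ik; exact: val_inj.
rewrite big1 ?mulr0// => i _; case: eqP => // E.
by have := ltn_ord i; rewrite E ltnNge kM.
Qed.

End TrigPolynomials.

(** * An extremal trigonometric polynomial from a test functional *)

Section LowerBound.
Context {R : realType}.
Variables (psi : R -> R) (beta : R) (n p m : nat).
Hypothesis psi0 : forall t, 1 <= t -> 0 < psi t.
Hypotheses (p0 : (0 < p)%N) (pn : (p <= n)%N) (m0 : (0 < m)%N).
Let n0 : (0 < n)%N := leq_trans p0 pn.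
Let th : R := beta * pi / 2.

Lemma U_periodic (f : R -> R) x : Defs.U psi n p f (x + 2 * pi) = Defs.U psi n p f x.
Proof.
apply: eq_bigr => k _; rewrite /Ak; case: eqP => // _.
by rewrite cos_nat_periodic sin_nat_periodic.
Qed.

Lemma cont_U (f : R -> R) : continuous (Defs.U psi n p f).
Proof.
rewrite /Defs.U; apply: cont_sum => k; apply: cont_mul; first by cont.
by rewrite /Ak; case: (k == 0%N); cont.
Qed.

(** A [sup] dominates its elements only when the set is bounded; continuity and periodicity provide
    that. *)
Lemma normC_ge (f : R -> R) x : in_C f ->
  `|f x - Defs.U psi n p f x| <= normC (fun x => f x - Defs.U psi n p f x).
Proof.
move=> [cf pf]; have cU := @cont_U f.
have tpi0 : 0 < 2 * pi :> R by rewrite mulr_gt0// pi_gt0.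
have [||B _ HB] := @periodic_bounded R (fun x => f x - Defs.U psi n p f x) _ tpi0.
- by cont.
- by move=> y; rewrite pf U_periodic.
apply: ub_le_sup; last by exists x.
by exists B => _ [y _ <-].
Qed.

(* [I] stands for integration against a fixed function of sup norm at most one and of mean
   zero; its de la Vallee Poussin mean is the trigonometric polynomial [phi] below. *)
Variable I : (R -> R) -> R.
Hypothesis ID : forall F G : R -> R, continuous F -> continuous G ->
  I (fun x => F x + G x) = I F + I G.
Hypothesis IZ : forall (c : R) (F : R -> R), continuous F -> I (fun x => c * F x) = c * I F.
Hypothesis Ile : forall F : R -> R, continuous F -> `|I F| <= itg (fun x => `|F x|) (- pi) pi.
Hypothesis I1 : I (fun=> 1) = 0.

Let Isum N (c : nat -> R) (F : nat -> R -> R) : (forall k, continuous (F k)) ->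
  I (fun x => \sum_(k < N) c k * F k x) = \sum_(k < N) c k * I (F k).
Proof.
move=> cF; elim: N => [|N IH].
  rewrite big_ord0; under eq_fun do rewrite big_ord0.
  rewrite -[RHS](mul0r (I (fun=> 1))) -IZ; last by cont.
  by congr I; apply/funext => x; rewrite mul0r.
rewrite big_ord_recr /=; under eq_fun do rewrite big_ord_recr /=.
by rewrite ID; [rewrite IH IZ|cont|cont].
Qed.

Let ac k := I (fun t => cos (k%:R * t)).
Let bc k := I (fun t => sin (k%:R * t)).

Let ac0 : ac 0 = 0.
Proof. by rewrite /ac; under eq_fun do rewrite mul0r cos0; rewrite I1. Qed.
Let bc0 : bc 0 = 0.
Proof.
rewrite /bc; under eq_fun do rewrite mul0r sin0.
rewrite -[RHS](mul0r (I (fun=> 1))) -IZ; last by cont.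
by congr I; apply/funext => x; rewrite mul0r.
Qed.

Let Icos k (u : R) : I (fun t => cos (k%:R * t + u)) = cos u * ac k - sin u * bc k.
Proof.
rewrite /ac /bc -IZ; last by cont.
rewrite -mulNr -IZ; last by cont.
rewrite -ID; [|by cont|by cont].
by congr I; apply/funext => t; rewrite cosD; ring.
Qed.

(** The L1 norm of [Vker] is at most pi ((n + m) + n) / m = pi [Dn]; dividing by it makes the mean
    of the test function bounded by 1. *)
Let Dn : R := 1 + 2 * n%:R / m%:R.
Let Dn0 : 0 < Dn.
Proof. by rewrite ltr_pwDl// divr_ge0// mulr_ge0. Qed.

Let cPn := @cont_Pker R (ramp n) n.
Let cPnm := @cont_Pker R (ramp (n + m)) (n + m).
Let cV : continuous (@Vker R n m).
Proof. by move: cPn cPnm => ? ?; rewrite /Vker; cont. Qed.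

Lemma itg_Vker_norm : itg (fun t => `|Vker n m t|) (- pi) pi <= pi * Dn.
Proof.
have pi0 := @pi_gt0 R; have m0' : m%:R != 0 :> R by rewrite pnatr_eq0 -lt0n.
have nm0 : (0 < n + m)%N by rewrite addn_gt0 n0.
apply: (@le_trans _ _ (itg (fun t => (n + m)%:R / m%:R * Pker (ramp (n + m)) (n + m) t
   + n%:R / m%:R * Pker (ramp n) n t) (- pi) pi)).
  apply: itg_le; [by cont|by cont|lra|move=> x xp].
  rewrite /Vker; apply: (le_trans (ler_normB _ _)).
  have h1 := fejer_ge0 nm0 xp; have h2 := fejer_ge0 n0 xp.
  by rewrite ger0_norm ?mulr_ge0// ger0_norm ?mulr_ge0.
rewrite itgD; [|by cont|by cont].
rewrite itgZ// itgZ// !itg_fejer// /Dn natrD.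
have -> : (n%:R + m%:R) / m%:R = n%:R / m%:R + 1 :> R by field.
lra.
Qed.

Let al k := vpw n m k * ac k / (pi * Dn).
Let be k := vpw n m k * bc k / (pi * Dn).
Let phi := tpoly (n + m) al be.

(** phi(x) is I applied to the translated [Vker], divided by pi [Dn]; the mean-zero condition
    removes the constant -1/2 of that kernel. *)
Let phi_le1 x : `|phi x| <= 1.
Proof.
have pi0 := @pi_gt0 R.
have D0 : 0 < pi * Dn by rewrite mulr_gt0.
have -> : phi x = I (fun t => Vker n m (t - x)) / (pi * Dn).
  have -> : (fun t => Vker n m (t - x)) = (fun t =>
      \sum_(k < n + m) vpw n m k * cos (k%:R * t + - (k%:R * x)) + - 2^-1 * 1).
    apply/funext => t; rewrite Vker_sum// mulr1; congr (_ + _).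
    by apply: eq_bigr => k _; rewrite mulrBr.
  rewrite ID; [|by cont|by cont].
  rewrite (IZ (- 2^-1) (F := fun=> 1)); last by cont.
  rewrite I1 mulr0 addr0 (Isum (n + m) (vpw n m)
    (F := fun k t => cos (k%:R * t + - (k%:R * x)))); last by move=> k; cont.
  rewrite mulr_suml; apply: eq_bigr => k _; rewrite Icos cosN sinN /al /be.
  by ring.
rewrite normrM [X in _ * X]ger0_norm ?invr_ge0 ?(ltW D0)// ler_pdivrMr// mul1r.
have cVx : continuous (fun t => Vker n m (t - x)) by move: cV => ?; cont.
apply: (le_trans (Ile cVx)).
have cVn : continuous (fun t : R => `|Vker n m t|) by exact: cont_norm cV.
have Vper y : `|Vker n m (y + 2 * pi)| = `|Vker n m y| :> R by rewrite /Vker !Pker_periodic.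
rewrite (_ : itg _ _ _ = itg (fun t => `|Vker n m t|) (- pi) pi); first exact: itg_Vker_norm.
rewrite (@itg_shift _ (fun t => `|Vker n m t|))//.
rewrite (_ : pi - x = (- pi - x) + 2 * pi); last by ring.
by rewrite (itg_periodic _ (- pi) cVn Vper); congr itg; ring.
Qed.

(** The rotation by -th and the factor psi(k) are undone by the (psi, beta)-derivative, which
    therefore maps f back to phi. *)
Let al' k := psi k%:R * (al k * cos th - be k * sin th).
Let be' k := psi k%:R * (al k * sin th + be k * cos th).
Let f := tpoly (n + m) al' be'.

Let al0 : al 0 = 0. Proof. by rewrite /al ac0 mulr0 mul0r. Qed.
Let be0 : be 0 = 0. Proof. by rewrite /be bc0 mulr0 mul0r. Qed.
Let al'0 : al' 0 = 0. Proof. by rewrite /al' al0 be0 !mul0r subr0 mulr0. Qed.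
Let be'0 : be' 0 = 0. Proof. by rewrite /be' al0 be0 !mul0r addr0 mulr0. Qed.

Let f_in : in_Cpsi psi beta f.
Proof.
split; first exact: tpoly_in_C.
exists phi; split; first by apply: continuous_measurable_fun; exact: (@cont_tpoly R (n + m) al be).
split; first by apply: aeW => t; exact: phi_le1.
split; first by rewrite fa_tpoly// al0 if_same.
move=> k k0; rewrite !fa_tpoly// !fb_tpoly//.
have pk : psi k%:R != 0 by rewrite gt_eqF// psi0// ler1n.
case: ifP => _; last by rewrite !mul0r addr0 subr0 mul0r.
rewrite -/th /al' /be'; split.
  have -> : psi k%:R * (al k * cos th - be k * sin th) * cos th +
     psi k%:R * (al k * sin th + be k * cos th) * sin th =
     psi k%:R * al k * (cos th ^+ 2 + sin th ^+ 2) by ring.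
  by rewrite cos2Dsin2 mulr1 mulrC mulKf.
have -> : psi k%:R * (al k * sin th + be k * cos th) * cos th -
     psi k%:R * (al k * cos th - be k * sin th) * sin th =
     psi k%:R * be k * (cos th ^+ 2 + sin th ^+ 2) by ring.
by rewrite cos2Dsin2 mulr1 mulrC mulKf.
Qed.

(** At the single point 0 the error of U on this f equals the left side, since damping and
    multipliers combine into the coefficients of [Ker]. *)
Lemma Err_ge :
  ((psi n%:R / (pi * Dn) * I (Ker n p th (tailseq psi n m) m))%:E <= Err psi beta n p)%E.
Proof.
have pn0 : 0 < psi n%:R by apply: psi0; rewrite ler1n.
have c0 : tailseq psi n m 0 = 1.
  by rewrite /tailseq addn0 divff ?gt_eqF// mul1r ramp0.
apply: (@le_trans _ _ (normC (fun x => f x - Defs.U psi n p f x))%:E); last first.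
  by apply: ereal_sup_ubound; exists f.
rewrite lee_fin; apply: le_trans (normC_ge 0 (proj1 f_in)).
apply: le_trans (ler_norm _).
rewrite le_eqVlt; apply/orP; left; apply/eqP.
have -> : Ker n p th (tailseq psi n m) m = (fun t =>
    \sum_(k < n + m) kcoef n p (tailseq psi n m) k * cos (k%:R * t + th)).
  by apply/funext => t; rewrite Ker_sum.
rewrite (Isum (n + m) (kcoef n p (tailseq psi n m)) (F := fun k t => cos (k%:R * t + th)));
  last by move=> k; cont.
rewrite (U_lamt psi n p f m 0) /f /tpoly -sumrB mulr_sumr.
apply: eq_bigr => k _; rewrite Icos mulr0 cos0 sin0 mulr1 mulr0 addr0.
have [k0|k0] := posnP k.
  by rewrite k0 kcoef0// al'0 /Ak eqxx fa_tpoly// al'0 if_same !mul0r mulr0 mulr0 subrr.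
have -> : Ak (tpoly (n + m) al' be') k 0 = al' k.
  by rewrite /Ak (gtn_eqF k0) mulr0 cos0 sin0 mulr1 mulr0 addr0 fa_tpoly// ltn_ord.
have [E1 E2] := kcoef_multiplier psi0 p0 pn m0 k0.
have -> : al' k - lamt psi n p k * al' k = (1 - lamt psi n p k) * al' k by ring.
rewrite /al' /al /be.
have -> : (1 - lamt psi n p k) * (psi k%:R * (vpw n m k * ac k / (pi * Dn) * cos th -
    vpw n m k * bc k / (pi * Dn) * sin th)) =
   ((1 - lamt psi n p k) * vpw n m k) * psi k%:R * (cos th * ac k - sin th * bc k) / (pi * Dn).
  by ring.
by rewrite E2 E1; ring.
Qed.

End LowerBound.

(** * The two-sided estimate *)

Section SignFunctional.
Context {R : realType}.
Implicit Types (u th e t : R) (n p L h : nat) (F G : R -> R).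

(** The smoothed sign changes sign under translation by pi, so the two half-periods cancel. *)
Lemma itg_ssin_period e u : 0 < e -> itg (ssin e) u (u + 2 * pi) = 0.
Proof.
move=> e0; have cs := @cont_ssin R e e0.
have anti x : ssin e (x + pi) = - ssin e x.
  by rewrite /ssin sinDpi normrN mulNr.
rewrite (itg_periodic u 0 cs); last first.
  by move=> x; rewrite (_ : x + 2 * pi = x + pi + pi) ?anti ?opprK//; ring.
rewrite add0r (itg_chasles _ _ pi).
have -> : itg (ssin e) pi (2 * pi) = itg (fun x => ssin e (x + pi)) 0 pi.
  by rewrite itg_shift// add0r; congr itg; ring.
under [X in _ + itg X _ _]eq_fun do rewrite anti.
by rewrite itgN// subrr.
Qed.

Lemma itg_ssin_mean e u n h : 0 < e -> (0 < n)%N ->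
  itg (fun t => ssin e (n%:R * t + u)) 0 (2 * pi * h%:R / n%:R) = 0.
Proof.
move=> e0 n0; have cs := @cont_ssin R e e0.
have n0' : n%:R != 0 :> R by rewrite pnatr_eq0 -lt0n.
rewrite (@itg_derT _ _ (fun t => prim (ssin e) (n%:R * t + u) / n%:R)); last 2 first.
- by cont.
- move=> x /=; apply: drv_eq; first apply: drv_mul; [|exact: drv_cst|].
    apply: (@drv_comp _ (prim (ssin e))); first exact: drv_prim.
    by repeat der1.
  by rewrite /=; field.
have E k : prim (ssin e) (2 * pi * k%:R + u) = prim (ssin e) u.
  elim: k => [|k IH]; first by rewrite mulr0 add0r.
  have := itg_ssin_period (2 * pi * k%:R + u) e0; rewrite /itg IH.
  rewrite (_ : 2 * pi * k%:R + u + 2 * pi = 2 * pi * k.+1%:R + u); last first.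
    by rewrite -natr1; ring.
  lra.
by rewrite mulr0 add0r [n%:R * _]mulrC divfK// E subrr.
Qed.

(** Integration over [-b, b] folded onto [0, b]. As [ssin] is odd, the test function is [sgr p L]
    times sgn(t) [ssin e (n t + th)]: it follows the odd factor 1/t as well as the sine. *)
Definition signed_itg n p L e th (b : R) (F : R -> R) : R :=
  itg (fun t => sgr p L * ssin e (n%:R * t + th) * F t) 0 b +
  itg (fun t => sgr p L * ssin e (n%:R * t - th) * F (- t)) 0 b.

Section Properties.
Variables (n p L : nat) (e th b : R).
Hypotheses (e0 : 0 < e) (b0 : 0 <= b <= pi).
Let cs := @cont_ssin R e e0.

Lemma signed_itg_D F G : continuous F -> continuous G ->
  signed_itg n p L e th b (fun x => F x + G x) = signed_itg n p L e th b F + signed_itg n p L e th b G.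
Proof.
move: cs => ? cF cG; rewrite /signed_itg.
under eq_fun do rewrite mulrDr; under [X in _ + itg X _ _]eq_fun do rewrite mulrDr.
rewrite itgD; [|by cont|by cont].
rewrite itgD; [|by cont|by cont].
ring.
Qed.

Lemma signed_itg_Z (c : R) F : continuous F ->
  signed_itg n p L e th b (fun x => c * F x) = c * signed_itg n p L e th b F.
Proof.
move: cs => ? cF; rewrite /signed_itg.
under eq_fun do rewrite mulrCA; under [X in _ + itg X _ _]eq_fun do rewrite mulrCA.
rewrite itgZ; last by cont.
rewrite itgZ; last by cont.
ring.
Qed.

Lemma signed_itg_le F : continuous F ->
  `|signed_itg n p L e th b F| <= itg (fun x => `|F x|) (- pi) pi.
Proof.
move: cs => ? cF; have /andP[b0' bp] := b0.
have cN : continuous (fun x => `|F x|) by cont.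
rewrite itg_sym//.
have H u (G : R -> R) : continuous G ->
    `|itg (fun t => sgr p L * ssin e (n%:R * t + u) * G t) 0 b| <= itg (fun t => `|G t|) 0 pi.
  move=> cG.
  have cI : continuous (fun t : R => sgr p L * ssin e (n%:R * t + u) * G t) by cont.
  apply: (le_trans (itg_norm cI b0')).
  apply: (@le_trans _ _ (itg (fun t => `|G t|) 0 b)).
    apply: itg_le => //; [by cont|by cont|move=> t _].
    rewrite normrM ler_piMl// normrM.
    have -> : `|sgr p L| = 1 :> R by case: (@sgr_cases R p L) => ->; rewrite ?normrN normr1.
    by rewrite mul1r; exact: ssin_le1.
  by apply: itg_le_itv => //; cont.
apply: (le_trans (ler_normD _ _)); apply: lerD; first exact: H.
by apply: (H (- th) (fun t => F (- t))); cont.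
Qed.

Lemma signed_itg_cst1 h : (0 < n)%N -> b = 2 * pi * h%:R / n%:R ->
  signed_itg n p L e th b (fun=> 1) = 0.
Proof.
move: cs => ? n0 bE; rewrite /signed_itg.
under eq_fun do rewrite mulr1; under [X in _ + itg X _ _]eq_fun do rewrite mulr1.
rewrite itgZ; last by cont.
rewrite itgZ; last by cont.
by rewrite bE !itg_ssin_mean// !mulr0 addr0.
Qed.

End Properties.
End SignFunctional.

(** * Both bounds for the supremum over the class *)

Section Bounds.
Context {R : realType}.
Variable psi : R -> R.
Hypothesis psiF : in_F psi.
Let psi0 t : 1 <= t -> 0 < psi t.
Proof. by have [[+ _] _] := psiF; apply. Qed.

Lemma tailseq0 n m : (0 < n)%N -> (0 < m)%N -> tailseq psi n m 0 = 1.
Proof.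
move=> n0 m0; have pn0 : 0 < psi n%:R by apply: psi0; rewrite ler1n.
by rewrite /tailseq addn0 divff ?gt_eqF// mul1r ramp0.
Qed.

Lemma normC_le_of_Ker beta n p f (B : R) (m1 : nat) : (0 < p)%N -> (p <= n)%N ->
  in_Cpsi psi beta f ->
  (forall m, (m1 <= m)%N -> (0 < m)%N ->
    psi n%:R / pi * itg (fun t => `|Ker n p (beta * pi / 2) (tailseq psi n m) m t|) (- pi) pi
      <= B) ->
  normC (fun x => f x - Defs.U psi n p f x) <= B.
Proof.
move=> p0 pn fC HB; have n0 : (0 < n)%N by apply: leq_trans pn.
apply: ge_sup; first by exists `|f 0 - Defs.U psi n p f 0|, 0.
move=> _ [x _ <-].
(* The damping length may depend on x and e, because B bounds the kernel for all large m. *)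
apply/ler_addgt0Pr => e e0.
have [m0 Hm] := Vker_cvg x (proj1 fC) n0 e0.
pose m := (maxn m0 m1).+1.
have mm0 : (m0 <= m)%N by rewrite /m leqW// leq_maxl.
have mm1 : (m1 <= m)%N by rewrite /m leqW// leq_maxr.
have := Hm m mm0 isT; rewrite -vp_mean//; last by have [[]] := fC.
set S := \sum_(k < _) _ => h.
have -> : f x - Defs.U psi n p f x = (S - Defs.U psi n p f x) - (S - f x) by ring.
apply: (le_trans (ler_normB _ _)); apply: lerD => //.
exact: le_trans (vp_error x psi0 p0 pn _ fC) (HB m mm1 _).
Qed.

Lemma inv_pi_bounds : 0 < (pi : R)^-1 <= 2^-1.
Proof.
rewrite invr_gt0 pi_gt0/= lef_pV2 ?posrE ?pi_gt0//.
exact: pi_ge2.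
Qed.

Lemma Err_bounds : exists C : R, forall (n p : nat) beta, (2 <= n)%N -> (0 < p)%N -> (p <= n)%N ->
  ((psi n%:R * (4 / pi ^+ 2 * Acoef psi n p - C))%:E <= Err psi beta n p)%E /\
  (Err psi beta n p <= (psi n%:R * (4 / pi ^+ 2 * Acoef psi n p + C))%:E)%E.
Proof.
have [C1 [C2 [C3 HT]]] := tailseq_scale psiF.
have [C HC] := @Ker_estimates R C1 C2 C3.
(* One unit for replacing |ln p - ln L| by [Acoef] (4 / pi^2 <= 1), one for the normalisation 1 +
   2n/m in the lower bound, and |C| because 2/pi <= 1. *)
exists (2 + `|C|) => n p beta n2 p0 pn.
have n0 : (0 < n)%N by apply: ltnW.
have pn0 : 0 < psi n%:R by apply: psi0; rewrite ler1n.
have [L L0 [LC HA HL]] := HT n n2.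
set A := Acoef psi n p; pose l : R := `|ln p%:R - ln L%:R|.
have := HA p p0; rewrite -/A -/l ler_norml => /andP[hA1 hA2].
have /andP[ip0 ip1] := inv_pi_bounds.
have pi0 := @pi_gt0 R; have pi2 := @pi_ge2 R.
set q := (pi : R)^-1 in ip0 ip1 *.
have qq : 4 / pi ^+ 2 = 4 * q * q :> R by rewrite -exprVn expr2 mulrA.
rewrite qq.
set th := beta * pi / 2.
have KE m th' : (L <= m)%N -> (0 < m)%N ->
  itg (fun t => `|Ker n p th' (tailseq psi n m) m t|) 0 pi <= 2 * q * l + C /\
  forall e b : R, 0 < e -> e * (p%:R + L%:R) <= 1 -> 1 <= b <= pi ->
  2 * q * l - C <=
  itg (fun t => sgr p L * ssin e (n%:R * t + th') * Ker n p th' (tailseq psi n m) m t) 0 b.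
  move=> Lm m0; have [t1 t2] := HL m Lm.
  exact: HC (tailseq_cvx psiF n0 m0) m0 (tailseq0 n0 m0) t1 t2.
have hC := ler_norm C; have hC' := normr_ge0 C.
have l0 : 0 <= l by rewrite /l.
have q1 : 4 * q * q <= 1 by nra.
split.
  pose Y := 4 * q * q * l - 2 * q * C.
  (* Y is the value to be reached. This m makes d |Y| <= 1 with d = 2n/m, so (Y - 1)(1 + d) <= Y and
     the division by 1 + d costs at most 1. *)
  pose m := maxn L (Num.truncn (2 * n%:R * `|Y|)).+1.
  have Lm : (L <= m)%N by rewrite leq_maxl.
  have m0 : (0 < m)%N by apply: leq_trans Lm.
  have m0' : 0 < m%:R :> R by rewrite ltr0n.
  pose d := 2 * n%:R / m%:R : R.
  have d0 : 0 <= d by rewrite divr_ge0// mulr_ge0.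
  have dY : d * `|Y| <= 1.
    rewrite /d mulrAC ler_pdivrMr// mul1r; apply: ltW.
    apply: (lt_le_trans (truncnS_gt _)); rewrite ler_nat.
    by rewrite leq_maxr.
  pose e := (p%:R + L%:R)^-1 : R.
  have pL : 0 < p%:R + L%:R :> R by rewrite addr_gt0 ?ltr0n.
  have e0 : 0 < e by rewrite invr_gt0.
  have eL : e * (p%:R + L%:R) <= 1 by rewrite mulVf// gt_eqF.
  (* This is n./2 full periods of length 2 pi / n. For n >= 2 one has n <= 3 n./2, hence 2 pi / 3 <=
     b <= pi. *)
  pose b := 2 * pi * (n./2)%:R / n%:R : R.
  have n0' : 0 < n%:R :> R by rewrite ltr0n.
  have half_bounds : (n <= n./2 + n./2 + n./2)%N && (n./2 + n./2 <= n)%N.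
    rewrite addnn -[X in (X <= _)%N]odd_double_half -[X in (_ <= X)%N && _]addnC.
    rewrite leq_add2r -[X in _ && (_ <= X)%N]odd_double_half leq_addl andbT.
    by apply: (leq_trans (leq_b1 _)); rewrite half_gt0.
  have bp : 1 <= b <= pi.
    have /andP[h1 h2] := half_bounds.
    move: h1 h2; rewrite -!(ler_nat R) !natrD => h1 h2.
    by rewrite /b ler_pdivlMr// ler_pdivrMr//; apply/andP; split; nra.
  have b0 : 0 <= b <= pi by have /andP[? ->] := bp; rewrite andbT; lra.
  pose I := signed_itg n p L e th b.
  have H := @Err_ge R psi beta n p m psi0 p0 pn m0 I
     (@signed_itg_D R n p L e th b e0) (@signed_itg_Z R n p L e th b e0)
     (@signed_itg_le R n p L e th b e0 b0) (@signed_itg_cst1 R n p L e th b e0 _ n0 erefl).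
  apply: (le_trans _ H); rewrite lee_fin -/th -/d.
  have IK : 2 * (2 * q * l - C) <= I (Ker n p th (tailseq psi n m) m).
    have [_ k1] := KE m th Lm m0; have [_ k2] := KE m (- th) Lm m0.
    have := k1 e b e0 eL bp; have := k2 e b e0 eL bp.
    rewrite /I /signed_itg.
    under [X in _ -> _ -> _ <= _ + itg X _ _]eq_fun do rewrite Ker_reflect ?tailseq0//.
    lra.
  rewrite invfM mulrA -/q -!mulrA ler_pM2l//.
  set W := I _ in IK *.
  have D0 : 0 < 1 + d by lra.
  have hY : Y <= q * W.
    have : q * (2 * (2 * q * l - C)) <= q * W by rewrite ler_wpM2l// ltW.
    rewrite /Y; lra.
  apply: (@le_trans _ _ (Y - 1)).
    have : 4 * q * q * A <= 4 * q * q * (l + 1).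
      by rewrite ler_wpM2l ?mulr_ge0 ?(ltW ip0)//; lra.
    have : q * C <= q * `|C| by rewrite ler_wpM2l// ltW.
    have : q * `|C| <= 2^-1 * `|C| by rewrite ler_wpM2r.
    rewrite /Y; lra.
  suff : Y - 1 <= q * W / (1 + d) by lra.
  rewrite ler_pdivlMr//.
  apply: (le_trans _ hY).
  have := ler_norm Y; nra.
apply: ge_ereal_sup => _ [f fC <-]; rewrite lee_fin.
apply: (normC_le_of_Ker (m1 := L) p0 pn fC) => m Lm m0.
rewrite -/th -/q -mulrA ler_pM2l//.
have cK := @cont_Ker R n p th (tailseq psi n m) m.
have cN : continuous (fun t : R => `|Ker n p th (tailseq psi n m) m t|) by cont.
rewrite itg_sym//.
under [X in _ * (_ + itg X _ _)]eq_fun do rewrite Ker_reflect ?tailseq0//.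
have [k1 _] := KE m th Lm m0; have [k2 _] := KE m (- th) Lm m0.
apply: (@le_trans _ _ (q * (2 * (2 * q * l + C)))).
  by rewrite ler_wpM2l ?(ltW ip0)//; lra.
have : 4 * q * q * l <= 4 * q * q * (A + 1).
  by rewrite ler_wpM2l ?mulr_ge0 ?(ltW ip0)//; lra.
have : q * C <= q * `|C| by rewrite ler_wpM2l// ltW.
have : q * `|C| <= 2^-1 * `|C| by rewrite ler_wpM2r.
lra.
Qed.

End Bounds.

Unset Implicit Arguments.
Set Strict Implicit.

Theorem theorem1 (R : realType) (psi : R -> R) :
  in_F psi ->
  exists (C : R) (N : nat), forall (n p : nat) (beta : R),
    (N <= n)%N -> (1 <= p)%N -> (p <= n)%N ->
    exists r : R, `|r| <= C /\
      Err psi beta n p = (psi n%:R * (4 / pi ^+ 2 * Acoef psi n p + r))%:E.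
Proof.
move=> psiF; have [C HC] := Err_bounds psiF.
(* From n = 2 on the argument of eta exceeds 1, where psi is continuous and the bound on the
   derivative of eta applies. *)
exists C, 2%N => n p beta n2 p0 pn.
have [lo up] := HC n p beta n2 p0 pn.
have pn0 : 0 < psi n%:R.
  by have [[+ _] _] := psiF; apply; rewrite ler1n ltnW.
(* The extended supremum lies between two real numbers, so it is finite, and r can be defined by
   division by psi(n). *)
have Efin : Err psi beta n p \is a fin_num.
  by rewrite fin_numE; apply/andP; split; apply/eqP => E; move: lo up; rewrite E.
rewrite -(fineK Efin) !lee_fin in lo up *; set E := fine _ in lo up *.
exists (E / psi n%:R - 4 / pi ^+ 2 * Acoef psi n p); split.
  rewrite ler_norml lerBlDr lerBrDr ler_pdivlMr// ler_pdivrMr//.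
  by rewrite ![_ * psi _]mulrC [- C + _]addrC [C + _]addrC lo up.
by rewrite addrC subrK mulrC divfK// gt_eqF.
Qed.
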